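(* Let $(Q,v)$ be a signed valued quiver of mutation Dynkin type with vertex set $\{1,\dots,n\}$, let $k\in\{1,\dots,n\}$ and $(Q',v')=\mu_k(Q,v)$. Write $\mathfrak g=\mathfrak g(Q,v)$, $\mathfrak g'=\mathfrak g(Q',v')$, and $\Phi,\Phi'$ for the root systems of $(Q,v),(Q',v')$. Let $\varphi_k:\mathfrak g'\to\mathfrak g$ be the Lie algebra isomorphism and $\rho_k:\Phi'\to\Phi$ the mutation of roots defined in the context. Then for every $\beta'\in\Phi'$, $$\varphi_k(\mathfrak g'^{\beta'})=\mathfrak g^{\rho_k(\beta')}.$$
   Context: **Gss matrices and mutation.** All matrices are $n\times n$. A generalized skew-symmetrizable (gss) matrix is $B=(b_{ij})$ with entries in $\mathbb Z[t]/(t^2-1)$ such that there are positive integers $d_1,\dots,d_n$ with $d_ib_{ij}=-d_jb_{ji}$ for all $i,j$. For a real number $a\neq0$, $\operatorname{sgn}(a)=a/|a|$, $\operatorname{sgn}(0)=0$; and $\operatorname{sgn}(a+bt)=\operatorname{sgn}(a+b)$. The signed mutation $\mu_k(B)=(b'_{ij})$ is: $b'_{ij}=-b_{ij}$ if ($i=k$ and $\operatorname{sgn}(b_{ij})=1$) or ($j=k$ and $\operatorname{sgn}(b_{ij})=-1$); $b'_{ij}=-tb_{ij}$ if ($i=k$ and $\operatorname{sgn}(b_{ij})=-1$) or ($j=k$ and $\operatorname{sgn}(b_{ij})=1$); $b'_{ij}=t(b_{ij}+\operatorname{sgn}(b_{ik})b_{ik}b_{kj})$ if $\operatorname{sgn}(b_{ik}b_{kj})=1$;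 $b'_{ij}=b_{ij}$ otherwise. Two gss matrices are mutation equivalent if one is obtained from the other by a finite sequence of mutations. $B$ is pure if every entry lies in $\mathbb Z\cup t\mathbb Z$. **Signed valued quivers.** A signed valued quiver $(Q,v)$ is a simple quiver $Q$ (no loops, at most one arrow between any two vertices) on $\{1,\dots,n\}$ with a function $v=(v_1,v_2)$ from arrows to $\mathbb Z\times\mathbb Z$ such that $\operatorname{sgn}(v_1(\alpha))=\operatorname{sgn}(v_2(\alpha))\ne0$ (this is the sign of $\alpha$) and there are positive integers $d_i$ with $d_iv_1(\alpha)=d_jv_2(\alpha)$ for every arrow $\alpha:i\to j$. Signed valued quivers correspond bijectively to pure gss matrices: $B(Q,v)=(b_{ij})$ has, for each arrow $\alpha:i\to j$, $b_{ij}=v_1(\alpha)$, $b_{ji}=-v_2(\alpha)$ if $\alpha$ is positive, and $b_{ij}=-tv_1(\alpha)$, $b_{ji}=tv_2(\alpha)$ if $\alpha$ is negative; other entries are $0$. **Mutation Dynkin.** The unsigned diagram of $(Q,v)$ has $v_1(\alpha)v_2(\alpha)$ edges between $i$ and $j$ for each arrow $\alpha:i\to j$, with ordering $i>j$ iff $|v_1(\alpha)|>|v_2(\alpha)|$ and $i<j$ iff $|v_1(\alpha)|<|v_2(\alpha)|$ (drawn as a multiple edge pointing from the larger to the smaller vertex). A gss matrix is Dynkin if it is pure and the unsigned diagram of its signed valued quiver is a Dynkin diagram ($A_n,B_n,C_n,D_n,E_n,F_4,G_2$); it is mutation Dynkin if it is mutation equivalent to a Dynkin one; $(Q,v)$ is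 mutation Dynkin if $B(Q,v)$ is. All mutation Dynkin gss matrices are pure, and for $(Q,v)$ mutation Dynkin, $\mu_k(Q,v)$ is the signed valued quiver associated with $\mu_k(B(Q,v))$. **Cartan counterpart.** $C(Q,v)=(c_{ij})$ has $c_{ii}=2$, $c_{ij}=v_1(\alpha)$ and $c_{ji}=v_2(\alpha)$ for each arrow $\alpha:i\to j$, and other entries $0$. **Lie algebras** (over $\mathbb C$). Write $[x_1,\dots,x_m]=[x_1,[x_2,[\dots,x_m]]]$. For $C=C(Q,v)$, $\mathfrak g(Q,v)$ is the Lie algebra with generators $h_i,e_{\varepsilon i}$ ($\varepsilon\in\{\pm1\}$, $1\le i\le n$) and relations, for $\varepsilon,\delta\in\{\pm1\}$: (R1) $[h_i,h_j]=0$; (R2) $[e_i,e_{-i}]=h_i$; (R3) $[h_i,e_{\varepsilon j}]=\varepsilon c_{ij}e_{\varepsilon j}$; (R4) $(\operatorname{ad}e_{\varepsilon i})^{-M+1}(e_{\delta j})=0$ with $M=\min\{0,\varepsilon\delta c_{ij}\}$; (R5) for every chordless cycle of $C$ (distinct indices $i_1,\dots,i_p$, $p\ge3$, with $c_{i_ai_b}\ne0$ for $a\neq b$ exactly when $a,b$ are cyclically adjacent), written from any starting point and in either direction, and every $\varepsilon_1\in\{\pm1\}$: $[e_{\varepsilon_1i_1},\dots,e_{\varepsilon_pi_p}]=0$ where $\varepsilon_{q+1}=-\operatorname{sgn}(c_{i_q,i_{q+1}})\varepsilon_q$; except that if some edge of the cycle has weight $c_{ij}c_{ji}>1$, the relation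 is imposed only when $i_1$ and $i_p$ are not both long, where a vertex $i$ of the cycle is called long if $|c_{ij}|>|c_{ji}|$ for some vertex $j$ of the cycle. Generators of $\mathfrak g'$ are written $h'_i,e'_{\varepsilon i}$. **The isomorphism $\varphi_k$.** $\varphi_k:\mathfrak g'\to\mathfrak g$ is the Lie algebra isomorphism with $e'_{\varepsilon i}\mapsto\frac{(-\varepsilon)^{c_{ki}}}{|c_{ki}|!}(\operatorname{ad}e_{-\delta\varepsilon k})^{|c_{ki}|}(e_{\varepsilon i})$ and $h'_i\mapsto h_i-c_{ik}h_k$ if $Q$ has an arrow $i\to k$ of sign $\delta$, and $e'_{\varepsilon i}\mapsto e_{\varepsilon i}$, $h'_i\mapsto h_i$ otherwise. **Roots.** Let $V$ be the real vector space with basis $\alpha_1,\dots,\alpha_n$ (formal simple roots for $(Q,v)$), $s_i:V\to V$ linear with $s_i(\alpha_j)=\alpha_j-c_{ij}\alpha_i$, $W=\langle s_1,\dots,s_n\rangle$, $\Phi=W\cdot\{\alpha_1,\dots,\alpha_n\}$. Similarly $\alpha'_i,\Phi'$ for $(Q',v')$ with $C'=C(Q',v')=(c'_{ij})$. The mutation of roots $\rho_k:\Phi'\to\Phi$ is the restriction of the linear map with $\alpha'_i\mapsto s_k(\alpha_i)$ if $i\to k$ in $Q$ and $\alpha'_i\mapsto\alpha_i$ otherwise. **Root spaces.** $\mathfrak h\subset\mathfrak g$, $\mathfrak h'\subset\mathfrak g'$ are the Cartan subalgebras generated by the $h_i$, respectively the $h'_i$. Roots act on $\mathfrak h$ by linear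 extension of $\alpha_i(h_j)=c_{ji}$ (and on $\mathfrak h'$ by $\alpha'_i(h'_j)=c'_{ji}$). For $\beta\in\Phi$, $\mathfrak g^\beta=\{x\in\mathfrak g: [h,x]=\beta(h)x\ \forall h\in\mathfrak h\}$, and similarly $\mathfrak g'^{\beta'}$. *)

(* Defs.v *)
From HB Require Import structures.
From mathcomp Require Import all_boot all_order all_algebra.
From mathcomp Require Import perm qpoly.
From mathcomp Require Import boolp classical_sets reals.
From mathcomp Require Import complex.

Set Implicit Arguments.
Unset Strict Implicit.
Unset Printing Implicit Defensive.

Import Order.TTheory GRing.Theory Num.Theory.
Local Open Scope ring_scope.
Local Open Scope quotient_scope.
Local Open Scope complex_scope.

HB.mixin Record Lmodule_isLieAlgebra (F : fieldType) L of GRing.Lmodule F L := {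
  lie_bracket : L -> L -> L;
  lie_bracketPl : forall (a : F) (x y z : L),
    lie_bracket (a *: x + y) z = a *: lie_bracket x z + lie_bracket y z;
  lie_bracketPr : forall (a : F) (x y z : L),
    lie_bracket x (a *: y + z) = a *: lie_bracket x y + lie_bracket x z;
  lie_bracketxx : forall x : L, lie_bracket x x = 0;
  lie_jacobi : forall x y z : L,
    lie_bracket x (lie_bracket y z) + lie_bracket y (lie_bracket z x)
      + lie_bracket z (lie_bracket x y) = 0
}.

#[short(type="lieAlgType")]
HB.structure Definition LieAlgebra (F : fieldType) :=
  {L of GRing.Lmodule F L & Lmodule_isLieAlgebra F L}.

Notation "[ 'lie' x , y ]" := (lie_bracket x y)
  (at level 0, x, y at level 200, format "[ 'lie'  x ,  y ]") : ring_scope.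

Definition lie_iso (F : fieldType) (L M : lieAlgType F)
    (f : {linear L -> M}) : Prop :=
  (forall x y : L, f [lie x, y] = [lie f x, f y]) /\ bijective f.

Inductive lie_generated (F : fieldType) (L : lieAlgType F) (A : set L) : L -> Prop :=
| lie_generated_gen x : A x -> lie_generated A x
| lie_generated0 : lie_generated A 0
| lie_generatedP (a : F) x y :
    lie_generated A x -> lie_generated A y -> lie_generated A (a *: x + y)
| lie_generated_bracket x y :
    lie_generated A x -> lie_generated A y -> lie_generated A [lie x, y].

(* The Lie algebra presented by generators X and relations S is the set of
   formal Lie expressions in X modulo the smallest congruence that satisfies
   the Lie algebra axioms and the relations; its universal property is
   [presLie_lift] and [presLie_lift_unique]. *)

Inductive lieterm (F : Type) (X : Type) : Type :=
| LVar of X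
| LZero
| LOpp of lieterm F X
| LAdd of lieterm F X & lieterm F X
| LScale of F & lieterm F X
| LBracket of lieterm F X & lieterm F X.

Arguments LZero {F X}.
Arguments LVar {F X} _.

Inductive lieeq (F : fieldType) (X : Type)
    (S : lieterm F X -> lieterm F X -> Prop) :
    lieterm F X -> lieterm F X -> Prop :=
| lieeq_rel x y : S x y -> lieeq S x y
| lieeq_refl x : lieeq S x x
| lieeq_sym x y : lieeq S x y -> lieeq S y x
| lieeq_trans x y z : lieeq S x y -> lieeq S y z -> lieeq S x z
| lieeq_opp x y : lieeq S x y -> lieeq S (LOpp x) (LOpp y)
| lieeq_add x x' y y' : lieeq S x x' -> lieeq S y y' ->
    lieeq S (LAdd x y) (LAdd x' y')
| lieeq_scale a x y : lieeq S x y -> lieeq S (LScale a x) (LScale a y)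
| lieeq_bracket x x' y y' : lieeq S x x' -> lieeq S y y' ->
    lieeq S (LBracket x y) (LBracket x' y')
| lieeq_addA x y z : lieeq S (LAdd x (LAdd y z)) (LAdd (LAdd x y) z)
| lieeq_addC x y : lieeq S (LAdd x y) (LAdd y x)
| lieeq_add0 x : lieeq S (LAdd LZero x) x
| lieeq_addN x : lieeq S (LAdd (LOpp x) x) LZero
| lieeq_scaleA a b x : lieeq S (LScale a (LScale b x)) (LScale (a * b) x)
| lieeq_scale1 x : lieeq S (LScale 1 x) x
| lieeq_scaleDr a x y :
    lieeq S (LScale a (LAdd x y)) (LAdd (LScale a x) (LScale a y))
| lieeq_scaleDl a b x :
    lieeq S (LScale (a + b) x) (LAdd (LScale a x) (LScale b x))
| lieeq_bracketPl a x y z :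
    lieeq S (LBracket (LAdd (LScale a x) y) z)
            (LAdd (LScale a (LBracket x z)) (LBracket y z))
| lieeq_bracketPr a x y z :
    lieeq S (LBracket x (LAdd (LScale a y) z))
            (LAdd (LScale a (LBracket x y)) (LBracket x z))
| lieeq_bracketxx x : lieeq S (LBracket x x) LZero
| lieeq_jacobi x y z :
    lieeq S (LAdd (LAdd (LBracket x (LBracket y z)) (LBracket y (LBracket z x)))
                  (LBracket z (LBracket x y))) LZero.

HB.instance Definition _ (F : Type) (X : Type) := gen_eqMixin (lieterm F X).
HB.instance Definition _ (F : Type) (X : Type) := gen_choiceMixin (lieterm F X).

Section Presentation.
Context (F : fieldType) (X : Type) (S : lieterm F X -> lieterm F X -> Prop).
Local Notation term := (lieterm F X).

Definition lieeqb : rel term := fun x y => `[< lieeq S x y >].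

Fact lieeqb_refl : reflexive lieeqb.
Proof. by move=> x; apply/asboolP; exact: lieeq_refl. Qed.
Fact lieeqb_sym : symmetric lieeqb.
Proof. by move=> x y; apply/asboolP/asboolP; exact: lieeq_sym. Qed.
Fact lieeqb_trans : transitive lieeqb.
Proof.
move=> y x z /asboolP xy /asboolP yz; apply/asboolP.
exact: lieeq_trans xy yz.
Qed.

Canonical lieeqb_equiv := EquivRel lieeqb lieeqb_refl lieeqb_sym lieeqb_trans.

Definition presLie : Type := {eq_quot lieeqb}.
HB.instance Definition _ := EqQuotient.on presLie.
HB.instance Definition _ := Choice.on presLie.

Local Notation cls := (\pi_presLie).

Lemma presLie_eqP (x y : term) : (cls x = cls y) <-> lieeq S x y.
Proof.
split=> [/eqP|xy]; first by rewrite eqmodE => /asboolP.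
by apply/eqP; rewrite eqmodE; apply/asboolP.
Qed.

Lemma presLie_repr (x : term) : lieeq S (repr (cls x)) x.
Proof. by apply/presLie_eqP; rewrite reprK. Qed.

Definition presLie_opp := lift_op1 presLie (@LOpp F X).
Definition presLie_add := lift_op2 presLie (@LAdd F X).
Definition presLie_scale (a : F) := lift_op1 presLie (@LScale F X a).
Definition presLie_bracket := lift_op2 presLie (@LBracket F X).

Lemma presLie_oppE x : presLie_opp (cls x) = cls (LOpp x).
Proof.
by unlock presLie_opp; apply/presLie_eqP; apply: lieeq_opp;
   exact: presLie_repr.
Qed.
Lemma presLie_addE x y : presLie_add (cls x) (cls y) = cls (LAdd x y).
Proof.
by unlock presLie_add; apply/presLie_eqP; apply: lieeq_add;
   exact: presLie_repr.
Qed.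
Lemma presLie_scaleE a x : presLie_scale a (cls x) = cls (LScale a x).
Proof.
by unlock presLie_scale; apply/presLie_eqP; apply: lieeq_scale;
   exact: presLie_repr.
Qed.
Lemma presLie_bracketE x y :
  presLie_bracket (cls x) (cls y) = cls (LBracket x y).
Proof.
by unlock presLie_bracket; apply/presLie_eqP; apply: lieeq_bracket;
   exact: presLie_repr.
Qed.

Definition presLieE :=
  (presLie_oppE, presLie_addE, presLie_scaleE, presLie_bracketE).

Fact presLie_addA : associative presLie_add.
Proof.
elim/quotW=> x; elim/quotW=> y; elim/quotW=> z; rewrite !presLieE.
by apply/presLie_eqP; exact: lieeq_addA.
Qed.
Fact presLie_addC : commutative presLie_add.
Proof.
elim/quotW=> x; elim/quotW=> y; rewrite !presLieE.
by apply/presLie_eqP; exact: lieeq_addC.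
Qed.
Fact presLie_add0 : left_id (cls LZero) presLie_add.
Proof.
by elim/quotW=> x; rewrite !presLieE; apply/presLie_eqP; exact: lieeq_add0.
Qed.
Fact presLie_addN : left_inverse (cls LZero) presLie_opp presLie_add.
Proof.
by elim/quotW=> x; rewrite !presLieE; apply/presLie_eqP; exact: lieeq_addN.
Qed.

HB.instance Definition _ := GRing.isZmodule.Build presLie
  presLie_addA presLie_addC presLie_add0 presLie_addN.

Fact presLie_scaleA a b (x : presLie) :
  presLie_scale a (presLie_scale b x) = presLie_scale (a * b) x.
Proof.
by elim/quotW: x => x; rewrite !presLieE; apply/presLie_eqP;
   exact: lieeq_scaleA.
Qed.
Fact presLie_scale1 : left_id 1 presLie_scale.
Proof.
by elim/quotW=> x; rewrite !presLieE; apply/presLie_eqP; exact: lieeq_scale1.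
Qed.
Fact presLie_scaleDr : right_distributive presLie_scale +%R.
Proof.
move=> a; elim/quotW=> x; elim/quotW=> y.
rewrite /GRing.add /= !presLieE.
by apply/presLie_eqP; exact: lieeq_scaleDr.
Qed.
Fact presLie_scaleDl (x : presLie) :
  {morph presLie_scale^~ x : a b / a + b}.
Proof.
elim/quotW: x => x a b; rewrite [RHS]/GRing.add /= !presLieE.
by apply/presLie_eqP; exact: lieeq_scaleDl.
Qed.

HB.instance Definition _ := GRing.Zmodule_isLmodule.Build F presLie
  presLie_scaleA presLie_scale1 presLie_scaleDr presLie_scaleDl.

Lemma presLie_addRE (x y : presLie) : x + y = presLie_add x y.
Proof. by []. Qed.
Lemma presLie_scaleRE a (x : presLie) : a *: x = presLie_scale a x.
Proof. by []. Qed.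
Lemma presLie_0E : 0 = cls LZero :> presLie.
Proof. by []. Qed.

Fact presLie_bracketPl a (x y z : presLie) :
  presLie_bracket (a *: x + y) z
    = a *: presLie_bracket x z + presLie_bracket y z.
Proof.
elim/quotW: x => x; elim/quotW: y => y; elim/quotW: z => z.
rewrite !presLie_addRE !presLie_scaleRE !presLieE.
by apply/presLie_eqP; exact: lieeq_bracketPl.
Qed.
Fact presLie_bracketPr a (x y z : presLie) :
  presLie_bracket x (a *: y + z)
    = a *: presLie_bracket x y + presLie_bracket x z.
Proof.
elim/quotW: x => x; elim/quotW: y => y; elim/quotW: z => z.
rewrite !presLie_addRE !presLie_scaleRE !presLieE.
by apply/presLie_eqP; exact: lieeq_bracketPr.
Qed.
Fact presLie_bracketxx (x : presLie) : presLie_bracket x x = 0.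
Proof.
by elim/quotW: x => x; rewrite presLieE presLie_0E; apply/presLie_eqP;
   exact: lieeq_bracketxx.
Qed.
Fact presLie_jacobi (x y z : presLie) :
  presLie_bracket x (presLie_bracket y z)
    + presLie_bracket y (presLie_bracket z x)
    + presLie_bracket z (presLie_bracket x y) = 0.
Proof.
elim/quotW: x => x; elim/quotW: y => y; elim/quotW: z => z.
rewrite !presLie_addRE !presLieE presLie_0E.
by apply/presLie_eqP; exact: lieeq_jacobi.
Qed.

HB.instance Definition _ := Lmodule_isLieAlgebra.Build F presLie
  presLie_bracketPl presLie_bracketPr presLie_bracketxx presLie_jacobi.

Definition presLie_gen (x : X) : presLie := cls (LVar x).

End Presentation.

Fixpoint lie_eval (F : fieldType) (X : Type) (L : lieAlgType F) (f : X -> L)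
    (u : lieterm F X) : L :=
  match u with
  | LVar x => f x
  | LZero => 0
  | LOpp u => - lie_eval f u
  | LAdd u v => lie_eval f u + lie_eval f v
  | LScale a u => a *: lie_eval f u
  | LBracket u v => [lie lie_eval f u, lie_eval f v]
  end.

Lemma lie_eval_lieeq (F : fieldType) (X : Type)
    (S : lieterm F X -> lieterm F X -> Prop) (L : lieAlgType F) (f : X -> L) :
  (forall u v, S u v -> lie_eval f u = lie_eval f v) ->
  forall u v, lieeq S u v -> lie_eval f u = lie_eval f v.
Proof.
move=> fS u v; elim=> /=; intros;
  first [ exact: fS | congruence | exact: addrA | exact: addrC | exact: add0r
        | exact: addNr | exact: scalerA | exact: scale1r | exact: scalerDr
        | exact: scalerDl | exact: lie_bracketPl | exact: lie_bracketPr
        | exact: lie_bracketxx | exact: lie_jacobi ].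
Qed.

Lemma presLie_evalE (F : fieldType) (X : Type)
    (S : lieterm F X -> lieterm F X -> Prop) (u : lieterm F X) :
  lie_eval (@presLie_gen F X S) u = \pi_(presLie S) u.
Proof.
elim: u => //= [u ->|u -> v ->|a u ->|u -> v ->].
- exact: presLie_oppE.
- exact: presLie_addE.
- exact: presLie_scaleE.
- exact: presLie_bracketE.
Qed.

Lemma presLie_lift (F : fieldType) (X : Type)
    (S : lieterm F X -> lieterm F X -> Prop) (L : lieAlgType F) (f : X -> L) :
  (forall u v, S u v -> lie_eval f u = lie_eval f v) ->
  exists2 g : {linear presLie S -> L},
    forall x y, g [lie x, y] = [lie g x, g y] &
    forall x, g (presLie_gen S x) = f x.
Proof.
move=> fS; pose g (x : presLie S) := lie_eval f (repr x).
have gE u : g (\pi_(presLie S) u) = lie_eval f u.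
  by apply: (lie_eval_lieeq fS); exact: presLie_repr.
have glin : linear g.
  move=> a; elim/quotW=> x; elim/quotW=> y.
  by rewrite presLie_addRE presLie_scaleRE !presLieE !gE.
pose G := GRing.isLinear.Build F (presLie S) L _ g glin.
pose GL : {linear presLie S -> L} := HB.pack g G.
exists GL => [|x]; last exact: gE.
elim/quotW=> x; elim/quotW=> y; rewrite -[lie_bracket _ _]/(presLie_bracket _ _).
by rewrite presLieE /= !gE.
Qed.

Lemma presLie_lift_unique (F : fieldType) (X : Type)
    (S : lieterm F X -> lieterm F X -> Prop) (L : lieAlgType F)
    (g g' : {linear presLie S -> L}) :
  (forall x y, g [lie x, y] = [lie g x, g y]) ->
  (forall x y, g' [lie x, y] = [lie g' x, g' y]) ->
  (forall x, g (presLie_gen S x) = g' (presLie_gen S x)) ->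
  g =1 g'.
Proof.
move=> gM g'M gg'; elim/quotW=> u; rewrite -presLie_evalE.
elim: u => //= [|u IH|u IHu v IHv|a u IH|u IHu v IHv].
- by rewrite !linear0.
- by rewrite !linearN IH.
- by rewrite !linearD IHu IHv.
- by rewrite !linearZ IH.
- by rewrite gM g'M IHu IHv.
Qed.

(* Z[t]/(t^2 - 1) *)

Definition zt : Type := {poly %/ ('X^2 - 1 : {poly int})}.
HB.instance Definition _ := GRing.ComNzRing.on zt.

Definition zt_t : zt := in_qpoly ('X^2 - 1) 'X.

Lemma zt_modulus : mk_monic ('X^2 - 1 : {poly int}) = 'X^2 - 1.
Proof.
have sz : size ('X^2 - 1 : {poly int}) = 3%N.
  by rewrite size_polyDl ?size_polyXn // size_polyN size_poly1.
rewrite /mk_monic sz /= monicE lead_coefDl ?lead_coefXn ?eqxx //.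
by rewrite size_polyN size_poly1 size_polyXn.
Qed.

Lemma zt_tt : zt_t * zt_t = 1.
Proof.
rewrite /zt_t -in_qpolyM -expr2 -in_qpoly1; apply/eqP; rewrite -subr_eq0.
rewrite -linearB; apply/eqP/val_inj => /=.
by rewrite zt_modulus Pdiv.RingMonic.rmodpp // -zt_modulus monic_mk_monic.
Qed.

(* [zt] consists of the remainders modulo X^2 - 1, so that x`_0 and x`_1 are the
   coordinates of x in the basis (1, t). *)
Definition sgzt (x : zt) : int :=
  sgz ((x : {poly int})`_0 + (x : {poly int})`_1).

Definition is_gss n (B : 'M[zt]_n) : Prop :=
  exists2 d : 'I_n -> nat, forall i, (0 < d i)%N &
    forall i j, B i j *+ d i = - (B j i *+ d j).

Definition mutation n (k : 'I_n) (B : 'M[zt]_n) : 'M[zt]_n :=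
  \matrix_(i, j)
    if ((i == k) && (sgzt (B i j) == 1)) || ((j == k) && (sgzt (B i j) == -1))
    then - B i j
    else if ((i == k) && (sgzt (B i j) == -1))
         || ((j == k) && (sgzt (B i j) == 1))
    then - (zt_t * B i j)
    else if sgzt (B i k * B k j) == 1
    then zt_t * (B i j + (B i k * B k j) *~ sgzt (B i k))
    else B i j.

Definition mutations n (s : seq 'I_n) (B : 'M[zt]_n) : 'M[zt]_n :=
  foldl (fun B k => mutation k B) B s.

Definition mutation_equivalent n (B B' : 'M[zt]_n) : Prop :=
  (exists s, B' = mutations s B) \/ (exists s, B = mutations s B').

Definition is_pure n (B : 'M[zt]_n) : Prop :=
  forall i j, exists m : int, B i j = m%:~R \/ B i j = zt_t * m%:~R.

(* The values of [arrow_v1] and [arrow_v2] at (i, j) are meaningful only if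
   there is an arrow i -> j, and are never used otherwise. *)
Record svquiver (n : nat) := SVQuiver {
  arrow : rel 'I_n;
  arrow_v1 : 'I_n -> 'I_n -> int;
  arrow_v2 : 'I_n -> 'I_n -> int;
  _ : forall i, ~~ arrow i i;
  _ : forall i j, arrow i j -> ~~ arrow j i;
  _ : forall i j, arrow i j ->
        sgz (arrow_v1 i j) = sgz (arrow_v2 i j) /\ sgz (arrow_v1 i j) != 0;
  _ : exists2 d : 'I_n -> nat, forall i, (0 < d i)%N &
        forall i j, arrow i j ->
          (d i)%:Z * arrow_v1 i j = (d j)%:Z * arrow_v2 i j
}.

Definition quiver_matrix n (Q : svquiver n) : 'M[zt]_n :=
  \matrix_(i, j)
    if arrow Q i j
    then (if 0 < arrow_v1 Q i j then (arrow_v1 Q i j)%:~R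
          else - (zt_t * (arrow_v1 Q i j)%:~R))
    else if arrow Q j i
    then (if 0 < arrow_v1 Q j i then - (arrow_v2 Q j i)%:~R
          else zt_t * (arrow_v2 Q j i)%:~R)
    else 0.

Record diagram (n : nat) := Diagram {
  edges : 'I_n -> 'I_n -> nat;
  larger : rel 'I_n
}.

Definition unsigned_diagram n (Q : svquiver n) : diagram n := {|
  edges := fun i j =>
    if arrow Q i j then `|(arrow_v1 Q i j * arrow_v2 Q i j)%R|%N
    else if arrow Q j i then `|(arrow_v1 Q j i * arrow_v2 Q j i)%R|%N
    else 0%N;
  larger := fun i j =>
    (arrow Q i j && (`|arrow_v2 Q i j| < `|arrow_v1 Q i j|)%N)
    || (arrow Q j i && (`|arrow_v1 Q j i| < `|arrow_v2 Q j i|)%N)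
|}.

Inductive dynkin_type : Type :=
  DynA of nat | DynB of nat | DynC of nat | DynD of nat | DynE of nat
| DynF4 | DynG2.

Definition dynkin_rank (T : dynkin_type) : nat :=
  match T with
  | DynA n | DynB n | DynC n | DynD n | DynE n => n
  | DynF4 => 4
  | DynG2 => 2
  end.

Definition dynkin_valid (T : dynkin_type) : bool :=
  match T with
  | DynA n => 0 < n
  | DynB n => 1 < n
  | DynC n => 2 < n
  | DynD n => 3 < n
  | DynE n => 5 < n < 9
  | DynF4 | DynG2 => true
  end%N.

(* Bourbaki's numbering of the vertices, shifted to start from 0. *)

(* Number of edges between i and j, for i < j. *)
Definition dynkin_bond (T : dynkin_type) (i j : nat) : nat :=
  match T with
  | DynA _ => j == i.+1
  | DynB n | DynC n => (j == i.+1) + ((j == i.+1) && (j == n.-1))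
  | DynD n => ((j == i.+1) && (j < n.-1)) || ((i == n - 3) && (j == n.-1))
  | DynE _ => [|| (i == 0) && (j == 2), (i == 1) && (j == 3)
                | (1 < i) && (j == i.+1)]
  | DynF4 => (j == i.+1) + ((i == 1) && (j == 2))
  | DynG2 => 3 * ((i == 0) && (j == 1))
  end%N.

Definition dynkin_edges (T : dynkin_type) (i j : nat) : nat :=
  if (i < j)%N then dynkin_bond T i j
  else if (j < i)%N then dynkin_bond T j i else 0%N.

Definition dynkin_larger (T : dynkin_type) (i j : nat) : bool :=
  match T with
  | DynB n => (i == n - 2) && (j == n.-1)
  | DynC n => (i == n.-1) && (j == n - 2)
  | DynF4 => (i == 1) && (j == 2)
  | DynG2 => (i == 1) && (j == 0)
  | _ => false
  end%N.

Definition is_dynkin_diagram n (D : diagram n) : Prop :=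
  exists T : dynkin_type,
    [/\ dynkin_valid T, dynkin_rank T = n &
        exists s : {perm 'I_n}, forall i j,
          edges D i j = dynkin_edges T (s i) (s j) /\
          larger D i j = dynkin_larger T (s i) (s j)].

Definition is_dynkin n (B : 'M[zt]_n) : Prop :=
  [/\ is_gss B, is_pure B &
      exists2 Q : svquiver n,
        B = quiver_matrix Q & is_dynkin_diagram (unsigned_diagram Q)].

Definition is_mutation_dynkin n (B : 'M[zt]_n) : Prop :=
  is_gss B /\ exists2 D : 'M[zt]_n, is_dynkin D & mutation_equivalent D B.

Definition quiver_mutation n (k : 'I_n) (Q Q' : svquiver n) : Prop :=
  quiver_matrix Q' = mutation k (quiver_matrix Q).

Definition cartan n (Q : svquiver n) : 'M[int]_n :=
  \matrix_(i, j)
    if i == j then 2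
    else if arrow Q i j then arrow_v1 Q i j
    else if arrow Q j i then arrow_v2 Q j i
    else 0.

(* Signs are encoded as booleans: b stands for (-1) ^ b, so that [~~] is the
   opposite and [(+)] the product. *)
Definition sign_of (b : bool) : int := (-1) ^+ b.

Definition arrow_sign n (Q : svquiver n) (i j : 'I_n) : bool :=
  arrow_v1 Q i j < 0.

Inductive generator (n : nat) : Type :=
| GenH of 'I_n
| GenE of bool & 'I_n.

Definition chordless_cycle n (C : 'M[int]_n) (s : seq 'I_n) : Prop :=
  [/\ (2 < size s)%N, uniq s &
      {in s &, forall i j, i != j ->
         (C i j != 0) = (j == next s i) || (i == next s j)}].

Definition has_multiple_edge n (C : 'M[int]_n) (s : seq 'I_n) : Prop :=
  exists i j, [/\ i \in s, j \in s, i != j & 1 < C i j * C j i].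

Definition is_long n (C : 'M[int]_n) (s : seq 'I_n) (i : 'I_n) : Prop :=
  exists2 j, j \in s & `|C j i| < `|C i j|.

Section Relations.
Context (F : fieldType) (n : nat) (C : 'M[int]_n).
Local Notation term := (lieterm F (generator n)).
Local Notation h i := (LVar (GenH i) : term).
Local Notation e eps i := (LVar (GenE eps i) : term).

(* [e_(eps i), [.., e_(eps_p i_p)]] along the sequence i :: s, the sign of each
   letter being -sgn(c_ij) times the sign of the previous one. *)
Fixpoint cycle_bracket (eps : bool) (i : 'I_n) (s : seq 'I_n) : term :=
  if s is j :: s'
  then LBracket (e eps i) (cycle_bracket (eps (+) (0 < C i j)) j s')
  else e eps i.

Inductive lie_relations : term -> term -> Prop :=
| LieR1 i j : lie_relations (LBracket (h i) (h j)) LZero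
| LieR2 i : lie_relations (LBracket (e false i) (e true i)) (h i)
| LieR3 i eps j :
    lie_relations (LBracket (h i) (e eps j))
                  (LScale (sign_of eps * C i j)%:~R (e eps j))
| LieR4 eps delta i j :
    lie_relations
      (iter `|(Num.min 0 (sign_of eps * sign_of delta * C i j))%R|%N.+1
            (LBracket (e eps i)) (e delta j))
      LZero
| LieR5 eps i s :
    chordless_cycle C (i :: s) ->
    (has_multiple_edge C (i :: s) ->
       ~ (is_long C (i :: s) i /\ is_long C (i :: s) (last i s))) ->
    lie_relations (cycle_bracket eps i s) LZero.

End Relations.

Definition lieQ (R : realType) n (Q : svquiver n) : Type :=
  presLie (@lie_relations R[i] n (cartan Q)).
HB.instance Definition _ (R : realType) n (Q : svquiver n) :=
  LieAlgebra.on (lieQ R Q).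

Definition hgen (R : realType) n (Q : svquiver n) (i : 'I_n) : lieQ R Q :=
  presLie_gen _ (GenH i).
Definition egen (R : realType) n (Q : svquiver n) (eps : bool) (i : 'I_n) :
    lieQ R Q := presLie_gen _ (GenE eps i).

(* The values on generators that determine phi_k : g(Q', v') -> g(Q, v). *)
Definition is_phi (R : realType) n (k : 'I_n) (Q Q' : svquiver n)
    (phi : lieQ R Q' -> lieQ R Q) : Prop :=
  let C := cartan Q in
  (forall eps i, phi (egen R Q' eps i) =
     if arrow Q i k
     then ((- (sign_of eps)%:~R) ^ C k i / (`|C k i|%N`!)%:R : R[i]) *:
          iter `|C k i|%N
            (lie_bracket (egen R Q (~~ (arrow_sign Q i k (+) eps)) k))
            (egen R Q eps i)
     else egen R Q eps i) /\
  (forall i, phi (hgen R Q' i) =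
     if arrow Q i k then hgen R Q i - (C i k)%:~R *: hgen R Q k
     else hgen R Q i).

Section Roots.
Context (R : realType) (n : nat).
Implicit Types (Q : svquiver n) (k i j : 'I_n) (beta : 'rV[R]_n).

Definition simple_root i : 'rV[R]_n := delta_mx 0 i.

Definition reflection Q i (v : 'rV[R]_n) : 'rV[R]_n :=
  v - (\sum_j v 0 j * (cartan Q i j)%:~R) *: simple_root i.

Inductive weyl_group Q : ('rV[R]_n -> 'rV[R]_n) -> Prop :=
| weyl1 : weyl_group Q id
| weyl_refl i : weyl_group Q (reflection Q i)
| weylM f g : weyl_group Q f -> weyl_group Q g -> weyl_group Q (f \o g)
| weylV f g : weyl_group Q f -> cancel f g -> cancel g f -> weyl_group Q g.

Definition root_system Q : set 'rV[R]_n :=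
  [set beta | exists w, exists2 i, weyl_group Q w & beta = w (simple_root i)].

Definition root_mutation Q k (v : 'rV[R]_n) : 'rV[R]_n :=
  \sum_i v 0 i *:
    (if arrow Q i k then reflection Q k (simple_root i) else simple_root i).

End Roots.

Definition cartan_subalgebra (R : realType) n (Q : svquiver n) :
    set (lieQ R Q) :=
  [set x | lie_generated (range (@hgen R n Q)) x].
Arguments cartan_subalgebra {R n} Q _.

(* The action of roots on the Cartan subalgebra, as the relation "beta takes the
   value c at x" (the bilinear extension of alpha_i (h_j) = c_ji), so that the
   definition does not rest on the linear independence of the h_j. It is
   defined on the whole Cartan subalgebra by [root_value_total]. *)
Definition root_value (R : realType) n (Q : svquiver n) (beta : 'rV[R]_n)
    (x : lieQ R Q) (c : R[i]) : Prop :=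
  exists2 a : 'I_n -> R[i],
    x = \sum_j a j *: hgen R Q j &
    c = \sum_j a j * \sum_i (beta 0 i)%:C * (cartan Q j i)%:~R.

Definition root_space (R : realType) n (Q : svquiver n) (beta : 'rV[R]_n) :
    set (lieQ R Q) :=
  [set x | forall h c, cartan_subalgebra Q h -> root_value beta h c ->
             [lie h, x] = c *: x].
Arguments root_space {R n} Q beta _.

Lemma hgen_comm (R : realType) n (Q : svquiver n) (i j : 'I_n) :
  [lie hgen R Q i, hgen R Q j] = 0.
Proof.
rewrite -[LHS]/(presLie_bracket _ _) presLie_bracketE presLie_0E.
by apply/presLie_eqP/lieeq_rel/LieR1.
Qed.

Lemma root_value_total (R : realType) n (Q : svquiver n) (beta : 'rV[R]_n)
    (x : lieQ R Q) :
  cartan_subalgebra Q x -> exists c, root_value beta x c.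
Proof.
move=> xh; suff [a xE] : exists a : 'I_n -> R[i], x = \sum_j a j *: hgen R Q j.
  by eexists; exists a => //; exact: erefl.
elim: xh => [_ [i _ <-]||a y z _ [b ->] _ [c ->]|y z _ [b ->] _ [c ->]].
- exists (fun j => (j == i)%:R); rewrite (bigD1 i) //= eqxx scale1r big1 ?addr0//.
  by move=> j /negPf ->; rewrite scale0r.
- by exists (fun=> 0); rewrite big1 // => j _; rewrite scale0r.
- exists (fun j => a * b j + c j); rewrite scaler_sumr -big_split.
  by apply: eq_bigr => j _; rewrite scalerA scalerDl.
- exists (fun=> 0); rewrite [RHS]big1 => [|j _]; last by rewrite scale0r.
  have bP (a : R[i]) (u v w : lieQ R Q) :
      [lie a *: u + v, w] = a *: [lie u, w] + [lie v, w] by exact: lie_bracketPl.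
  have bP' (a : R[i]) (u v w : lieQ R Q) :
      [lie w, a *: u + v] = a *: [lie w, u] + [lie w, v] by exact: lie_bracketPr.
  have b0 w : [lie (0 : lieQ R Q), w] = 0.
    by have := bP (-1) 0 0 w; rewrite scaler0 addr0 scaleN1r addNr.
  have b0' w : [lie w, (0 : lieQ R Q)] = 0.
    by have := bP' (-1) 0 0 w; rewrite scaler0 addr0 scaleN1r addNr.
  have bs : forall w, (forall j, [lie hgen R Q j, w] = 0) ->
      [lie \sum_j b j *: hgen R Q j, w] = 0.
    move=> w hw; elim/big_ind: _ => // [u v u0 v0|j _].
      by rewrite -[u]scale1r bP u0 v0 scaler0 addr0.
    by rewrite -[X in [lie X, _]]addr0 bP hw b0 scaler0 addr0.
  apply: bs => i; elim/big_ind: _ => // [u v u0 v0|j _].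
    by rewrite -[u]scale1r bP' u0 v0 scaler0 addr0.
  by rewrite -[X in [lie _, X]]addr0 bP' hgen_comm b0' scaler0 addr0.
Qed.

(* Main.v *)
(* Since [phi] is an isomorphism sending h'_j to h_j - [j -> k] c_jk h_k, it maps
   root spaces to root spaces, and the roots match as soon as
     c'_ij = c_ij - c_ik c_kj when exactly one of i -> k, j -> k holds, and
     c'_ij = c_ij otherwise.
   At t = 1 the signed mutation is Fomin-Zelevinsky mutation, and the formula
   holds provided every triangle through k is cyclically oriented and has
   |c_ij| <= |c_ik c_kj|. This follows, as in Barot-Geiss-Zelevinsky, from an
   invariant of mutation classes of Dynkin matrices: C is (symmetrizable) positive
   definite and every chordless cycle is cyclically oriented. Positivity forces an
   odd number of positive c_ij on each chordless cycle, because otherwise, after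
   changing signs of basis vectors, the sum of the normalized vectors of the cycle
   would have norm at most 0; comparing these parities before and after mutation
   excludes nonoriented cycles. For a Dynkin diagram positivity follows from a
   positive vector l with 2 l_i > sum_(j != i) |c_ij| l_j, for any choice of signs. *)

Require Import Defs.
From HB Require Import structures.
From mathcomp Require Import all_boot all_order all_algebra.
From mathcomp Require Import perm qpoly.
From mathcomp Require Import boolp classical_sets reals.
From mathcomp Require Import complex.
From mathcomp Require Import zify ring lra.

Set Implicit Arguments.
Unset Strict Implicit.
Unset Printing Implicit Defensive.

Import Order.TTheory GRing.Theory Num.Theory.
Local Open Scope classical_set_scope.
Local Open Scope ring_scope.

(** * Chordless cycles and parities *)

Section InducedCycles.
Variable T : eqType.
Implicit Types (e g : rel T) (x y : T) (p s t : seq T).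

Fixpoint induced_path e x p :=
  if p is y :: p' then
    [&& e x y, all (fun z => ~~ e x z) p' & induced_path e y p']
  else true.

(** The first vertex is an apex over an induced path, joined to its two ends only. This form suits
    cycles through the mutation vertex; [induced_cycle_rot] makes the choice of apex immaterial. *)
Definition induced_cycle e s :=
  [&& (2 < size s)%N, uniq s &
   if s is k :: u :: p then
     [&& induced_path e u p, e k u, e k (last u p)
       & all (fun z => ~~ e k z) (behead (belast u p))]
   else false].

Lemma induced_cycleE e k u t v :
  induced_cycle e (k :: u :: rcons t v) =
  [&& uniq (k :: u :: rcons t v), induced_path e u (rcons t v), e k u, e k v
    & all (fun z => ~~ e k z) t].
Proof. by rewrite /induced_cycle last_rcons belast_rcons /= size_rcons. Qed.

Lemma induced_cycle_split e s : induced_cycle e s ->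
  exists k u t v, s = k :: u :: rcons t v.
Proof.
case: s => [|k [|u p]]; rewrite /induced_cycle ?andbF //.
by case/lastP: p => // t v _; exists k, u, t, v.
Qed.

Lemma induced_path_rcons e x p w :
  induced_path e x (rcons p w) =
  [&& induced_path e x p, e (last x p) w & all (fun z => ~~ e z w) (belast x p)].
Proof.
elim: p x => [|y p IH] x /=; first by rewrite !andbT.
rewrite IH all_rcons.
case: (e x y); rewrite /= ?andbF //.
case: (e x w); rewrite /= ?andbF //.
by rewrite -andbA.
Qed.

Lemma induced_path_cat e x p q : induced_path e x (p ++ q) ->
  induced_path e x p && induced_path e (last x p) q.
Proof.
elim: p x => [|y p IH] x //= /and3P[-> ]; rewrite all_cat => /andP[-> _] /IH.
by [].
Qed.

Lemma induced_path_path e x p : induced_path e x p -> path e x p.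
Proof. by elim: p x => //= y p IH x /and3P[-> _ /IH]. Qed.

Lemma induced_cycle_rot1 e s : symmetric e ->
  induced_cycle e s -> induced_cycle e (rot 1 s).
Proof.
move=> esym ics; have [k [u [t [v sE]]]] := induced_cycle_split ics.
move: ics; rewrite sE rot1_cons; case: t {sE} => [|t0 t].
  rewrite -[rcons (_ :: _) _]/(u :: v :: rcons [::] k) !induced_cycleE.
  case/and5P=> U /= /andP[uv _] ku kv _.
  rewrite /= uv [e u k]esym ku [e v k]esym kv /= !andbT !inE; move: U => /=.
  rewrite !inE !andbT => /andP[/norP[kNu kNv] uNv].
  by rewrite negb_or uNv eq_sym kNu eq_sym kNv.
rewrite induced_cycleE => /and5P[U].
rewrite rcons_cons => /= /and3P[ut0 ut I] ku kv /andP[kt0 kt].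
rewrite -[X in induced_cycle e X]/(u :: t0 :: rcons (rcons t v) k).
rewrite induced_cycleE induced_path_rcons I.
rewrite last_rcons esym kv belast_rcons /= ut0 [e u k]esym ku esym kt0 ut !andbT /=.
apply/andP; split; last by apply/allP => z /(allP kt); rewrite esym.
by have := rot_uniq 1 (k :: u :: t0 :: rcons t v); rewrite rot1_cons U.
Qed.

Lemma induced_cycle_rot e m s : symmetric e ->
  induced_cycle e s -> induced_cycle e (rot m s).
Proof.
move=> esym ics; elim: m => [|m IH]; first by rewrite rot0.
have [lt|ge] := ltnP m (size s); last by rewrite rot_oversize // ltnW.
by rewrite (rotS lt); apply: induced_cycle_rot1.
Qed.

Lemma eq_in_induced_path e e' x p : {in x :: p &, e =2 e'} ->
  induced_path e x p = induced_path e' x p.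
Proof.
elim: p x => //= y p IH x E.
rewrite E ?inE ?eqxx ?orbT //; congr [&& _, _ & _].
  apply: eq_in_all => z zp; rewrite E ?inE ?eqxx ?zp ?orbT //.
by apply: IH => a b ain bin; apply: E; rewrite inE ?ain ?bin orbT.
Qed.

Lemma eq_in_induced_cycle e e' s : {in s &, e =2 e'} ->
  induced_cycle e s -> induced_cycle e' s.
Proof.
move=> E ics; have [k [u [t [v sE]]]] := induced_cycle_split ics.
move: ics E; rewrite sE !induced_cycleE => /and5P[-> I ku kv kt] E.
rewrite -(@eq_in_induced_path e); last first.
  by move=> a b ain bin; apply: E; rewrite inE ?ain ?bin orbT.
rewrite I -!E ?inE ?mem_rcons ?inE ?eqxx ?orbT // ku kv /=.
apply/allP => z zt; rewrite -E ?(allP kt) ?inE ?mem_rcons ?inE ?zt ?eqxx ?orbT //.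
Qed.

Lemma induced_cycle_uniq e s : induced_cycle e s -> uniq s.
Proof. by case/and3P. Qed.

Lemma induced_cycle_cycle e s : symmetric e -> induced_cycle e s -> cycle e s.
Proof.
move=> esym ics; have [k [u [t [v sE]]]] := induced_cycle_split ics.
move: ics; rewrite sE induced_cycleE => /and5P[_ I ku kv _] /=.
by rewrite ku rcons_path (induced_path_path I) last_rcons esym.
Qed.

(** Rotating a vertex of [q] to the apex puts the arc inside the opposite path. With [q] empty, the
    ends [u] and [v] would be joined to each other. *)
Lemma induced_cycle_arc e u t v q : symmetric e -> q != [::] ->
  induced_cycle e (u :: t ++ v :: q) -> induced_path e u (rcons t v).
Proof.
move=> esym; case: q => // r q _ ics.
have := induced_cycle_rot (size (u :: rcons t v)) esym ics.
rewrite -cat_rcons -cat_cons rot_size_cat /= => /and3P[_ _].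
case: q {ics} => /= [|r0 q].
  by case/and4P=> I _ _ _.
by case/and4P=> /induced_path_cat /andP[_ /= /and3P[_ _ ->]].
Qed.

Fixpoint parity g x p := if p is y :: p' then g x y (+) parity g y p' else false.

Definition cycle_parity g s := if s is x :: p then parity g x (rcons p x) else false.

Lemma parity_cat g x p q :
  parity g x (p ++ q) = parity g x p (+) parity g (last x p) q.
Proof. by elim: p x => //= y p IH x; rewrite IH addbA. Qed.

Lemma parity_rcons g x p w :
  parity g x (rcons p w) = parity g x p (+) g (last x p) w.
Proof. by rewrite -cats1 parity_cat /= addbF. Qed.

Lemma eq_in_parity g g' x p : {in x :: p &, g =2 g'} ->
  parity g x p = parity g' x p.
Proof.
elim: p x => //= y p IH x E; rewrite E ?inE ?eqxx ?orbT //; congr (_ (+) _).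
by apply: IH => a b ain bin; apply: E; rewrite inE ?ain ?bin orbT.
Qed.

Lemma split_first (P : pred T) p : has P p ->
  exists t v q, [/\ p = t ++ v :: q, P v & all (predC P) t].
Proof.
elim: p => //= x p IH; case: (boolP (P x)) => [Px _|nPx /=].
  by exists [::], x, p.
by case/IH=> t [v [q [-> Pv at_]]]; exists (x :: t), v, q; rewrite /= nPx.
Qed.

(** Induction on the length, cutting at the next vertex in [P]: the values of [f] at the cuts
    telescope modulo 2. *)
Lemma parity_segments (P : pred T) g (f : T -> bool) x p :
  P x -> P (last x p) ->
  (forall q1 u t v q2, x :: p = q1 ++ u :: t ++ v :: q2 -> P u -> P v ->
     all (predC P) t -> parity g u (rcons t v) = f u (+) f v) ->
  parity g x p = f x (+) f (last x p).
Proof.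
have [m] := ubnP (size p); elim: m => // m IH in x p *.
rewrite ltnS => lep Px Pl H.
case: p => [|y p] in lep Pl H *; first by rewrite /= addbb.
have hasP : has P (y :: p) by apply/hasP; exists (last x (y :: p)) => //=; exact: mem_last.
have [t [v [q [E Pv At]]]] := split_first hasP.
rewrite E -cat_rcons parity_cat last_cat last_rcons.
have lq : (size q < m)%N.
  by apply: leq_trans lep; rewrite E size_cat /= addnS ltnS leq_addl.
rewrite (IH v q) //; last 2 first.
- by move: Pl; rewrite E last_cat.
- move=> q1 a b c q2 E2; apply: (H (x :: t ++ q1)); rewrite E E2 /=.
  by rewrite -catA.
by rewrite (H [::] x t v q) ?E //= addbA addbK.
Qed.

End InducedCycles.

(** * Positive companions *)

Section Gram.
Variables (R : realFieldType) (T : eqType) (e : rel T) (a : T -> T -> R).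
Implicit Types (x y z : T) (p s t : seq T).
Hypothesis aC : forall x y, a x y = a y x.
Hypothesis axx : forall x, a x x = 2.
Hypothesis a0 : forall x y, x != y -> ~~ e x y -> a x y = 0.

(** When [a] is a Gram matrix, this is the squared norm of the sum of the vectors along [s]. *)
Let gram s := \sum_(y <- s) \sum_(z <- s) a y z.

Lemma gram_cons x s : gram (x :: s) = 2 + 2 * \sum_(z <- s) a x z + gram s.
Proof.
rewrite /gram !big_cons axx; under [X in _ + X = _]eq_bigr do rewrite big_cons.
rewrite big_split /=; under [X in _ + (X + _) = _]eq_bigr do rewrite aC.
by ring.
Qed.

Lemma gram_sum0 x s : x \notin s -> all (fun z => ~~ e x z) s ->
  \sum_(z <- s) a x z = 0.
Proof.
move=> xs /allP es; rewrite big_seq big1 // => z zs.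
by rewrite a0 ?es //; apply: contraNneq xs => ->.
Qed.

(** A new first vertex contributes 2 from the diagonal and at most -2 from its only edge. *)
Lemma gram_path x p : uniq (x :: p) -> induced_path e x p ->
  path (fun y z => a y z <= -1) x p -> gram (x :: p) <= 2.
Proof.
elim: p x => [|y p IH] x; first by rewrite gram_cons /gram !big_nil mulr0 !addr0.
rewrite cons_uniq => /andP[]; rewrite inE negb_or => /andP[_ xp] U.
case/and3P=> _ exp I /= /andP[axy P].
rewrite gram_cons big_cons gram_sum0 //; have := IH y U I P; lra.
Qed.

(** The apex contributes 2 from the diagonal and at most -4 from its two edges, on top of a path of
    norm at most 2. *)
Lemma gram_cycle s : induced_cycle e s -> cycle (fun y z => a y z <= -1) s ->
  gram s <= 0.
Proof.
move=> ics; have [k [u [t [v sE]]]] := induced_cycle_split ics; move: ics.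
rewrite sE induced_cycleE /= rcons_path last_rcons => /and5P[].
case/andP=> + U I _ _ kt /and3P[aku P avk].
rewrite inE mem_rcons inE !negb_or => /and3P[_ _ kNt].
rewrite gram_cons big_cons -cats1 big_cat big_seq1 /= gram_sum0 // cats1.
have := gram_path U I P; rewrite aC in avk; lra.
Qed.

End Gram.

(** A path contains no cycle, so every edge labelling is a coboundary: the sign of a new first
    vertex is fixed by its only edge. *)
Lemma path_signs (T : eqType) (g : rel T) x p : uniq (x :: p) ->
  exists eps : T -> bool, path (fun y z => eps y (+) eps z == g y z) x p.
Proof.
elim: p x => [|y p IH] x; first by exists (fun=> false).
rewrite cons_uniq => /andP[xp /IH[eps P]].
exists (fun z => if z == x then eps y (+) g x y else eps z) => /=.
rewrite eqxx; have /negPf -> : y != x.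
  by apply: contraNneq xp => ->; rewrite mem_head.
rewrite addbAC addbb eqxx /=.
have zNx z : z \in y :: p -> (z == x) = false.
  by move=> zp; apply/negbTE; apply: contraNneq xp => <-.
rewrite (@eq_in_path _ (mem (y :: p)) _ (fun y z => eps y (+) eps z == g y z)) //.
  by move=> a b /= ain bin; rewrite !zNx.
by apply/allP.
Qed.

Lemma signs_parity (T : eqType) (g : rel T) (eps : T -> bool) x p :
  path (fun y z => eps y (+) eps z == g y z) x p ->
  parity g x p = eps x (+) eps (last x p).
Proof.
elim: p x => [|y p IH] x /=; first by rewrite addbb.
by case/andP=> /eqP <- /IH ->; rewrite addbA addbK.
Qed.

Definition adjacent n (C : 'I_n -> 'I_n -> int) : rel 'I_n :=
  fun i j => (i != j) && (C i j != 0).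

Definition quad_form (R : rcfType) n (d : 'I_n -> nat) (C : 'I_n -> 'I_n -> int)
    (x : 'I_n -> R) : R :=
  \sum_i \sum_j (d i)%:R * (C i j)%:~R * x i * x j.

Record symmetrizable_by n (d : 'I_n -> nat) (C : 'I_n -> 'I_n -> int) : Prop := {
  sym_gt0 : forall i, (0 < d i)%N;
  symE : forall i j, (d i)%:Z * C i j = (d j)%:Z * C j i;
  sym_diag : forall i, C i i = 2 }.

(** A positive quasi-Cartan matrix: off-diagonal entries may have either sign. *)
Definition positive_by (R : rcfType) n d (C : 'I_n -> 'I_n -> int) : Prop :=
  symmetrizable_by d C /\
  forall x : 'I_n -> R, (exists i, x i != 0) -> 0 < quad_form d C x.

Section Companion.
Variables (n : nat) (d : 'I_n -> nat) (C : 'I_n -> 'I_n -> int).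
Hypothesis Csym : symmetrizable_by d C.

Lemma symE_ring (A : pzRingType) i j :
  (d i)%:R * (C i j)%:~R = (d j)%:R * (C j i)%:~R :> A.
Proof.
have := congr1 (fun z : int => z%:~R : A) (symE Csym i j).
by rewrite /= !rmorphM /= -!pmulrn.
Qed.

Lemma companion_sgz i j : sgz (C i j) = sgz (C j i).
Proof.
have := congr1 (@sgz _) (symE Csym i j); rewrite !sgzM.
by rewrite [sgz (d i)%:Z]gtr0_sgz 1?[sgz (d j)%:Z]gtr0_sgz ?ltz_nat ?(sym_gt0 Csym) // !mul1r.
Qed.

Lemma adjacent_sym : symmetric (adjacent C).
Proof.
by move=> i j; rewrite /adjacent eq_sym -[C i j == 0]sgz_eq0 companion_sgz sgz_eq0.
Qed.

Lemma companion_gt0 i j : (0 < C i j) = (0 < C j i).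
Proof. by rewrite -sgz_gt0 companion_sgz sgz_gt0. Qed.

Lemma companion_mul_ge1 i j : adjacent C i j -> 1 <= C i j * C j i.
Proof.
case/andP=> _ nz; rewrite -gtz0_ge1 -sgz_gt0 sgzM -(companion_sgz i j).
by rewrite -expr2 exprn_even_gt0 //= sgz_eq0.
Qed.

End Companion.

Lemma positive_cycle_parity (R : rcfType) n d (C : 'I_n -> 'I_n -> int) s :
  positive_by R d C -> induced_cycle (adjacent C) s ->
  cycle_parity (fun i j => 0 < C i j) s.
Proof.
move=> [Csym Cpos] ics; apply: contraT => even.
have d_gt0 i : 0 < (d i)%:R :> R by rewrite ltr0n (sym_gt0 Csym).
pose r i : R := Num.sqrt (d i)%:R.
have r_gt0 i : 0 < r i by rewrite sqrtr_gt0.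
have r2 i : r i * r i = (d i)%:R by rewrite -expr2 sqr_sqrtr // ltW.
have dC i j : (d i)%:R * (C i j)%:~R = (d j)%:R * (C j i)%:~R :> R.
  exact: symE_ring.
(* Signs chosen along the path also match the closing edge, because the number of positive edges is
   even. *)
have [eps epsE] : exists eps : 'I_n -> bool,
    cycle (fun y z => eps y (+) eps z == (0 < C y z)) s.
  case: s ics even => // x p ics; rewrite /= parity_rcons => even.
  have [eps P] := path_signs (fun y z => 0 < C y z) (induced_cycle_uniq ics).
  exists eps; rewrite /= rcons_path P.
  move: even; rewrite (signs_parity P).
  by case: (eps x); case: (eps (last x p)); case: (0 < C _ x).
(* The basis vectors, scaled to squared norm 2 and switched by [eps]. *)
pose w i : R := (-1) ^+ eps i / r i.
pose a i j := (d i)%:R * (C i j)%:~R * w i * w j.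
have w2 i : w i * w i = (d i)%:R^-1.
  by rewrite /w mulrACA -invfM r2 -expr2 sqrr_sign mul1r.
have aC i j : a i j = a j i by rewrite /a dC mulrAC.
have axx i : a i i = 2.
  rewrite /a (sym_diag Csym) -mulrA w2 mulrAC mulfV ?mul1r // lt0r_neq0 //.
have a0 i j : i != j -> ~~ adjacent C i j -> a i j = 0.
  by move=> ij; rewrite /adjacent ij negbK => /eqP e0; rewrite /a e0 mulr0 !mul0r.
have aN1 i j : adjacent C i j -> eps i (+) eps j == (0 < C i j) -> a i j <= -1.
  move=> Aij /eqP sij.
  (* The square is the positive integer C_ij C_ji; integrality turns a nonpositive entry into one
     that is at most -1. *)
  have a2 : 1 <= a i j * a i j.
    have -> : a i j * a i j = (C i j * C j i)%:~R.
      rewrite [X in _ * X]aC /a rmorphM /=.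
      transitivity ((C i j)%:~R * (C j i)%:~R * ((d i)%:R * (w i * w i))
                    * ((d j)%:R * (w j * w j))); first by ring.
      by rewrite !w2 !mulfV ?lt0r_neq0 // !mulr1.
    by rewrite -[1]/(1%:~R) ler_int; apply: (companion_mul_ge1 Csym).
  have aneg : a i j <= 0.
    have -> : a i j = (d i)%:R / (r i * r j) * ((C i j)%:~R * (-1) ^+ (eps i (+) eps j)).
      by rewrite /a /w signr_addb invfM; ring.
    rewrite mulr_ge0_le0 //; first by rewrite divr_ge0 ?mulr_ge0 // ltW.
    rewrite sij.
    case: (ltP 0 (C i j)) => Cij; rewrite /= ?expr0 ?expr1 ?mulrN1 ?mulr1.
      by rewrite oppr_le0 ler0z ltW.
    by rewrite lerz0.
  by nra.
have cyc : cycle (fun y z => a y z <= -1) s.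
  have := induced_cycle_cycle (adjacent_sym Csym) ics.
  have sub : subrel [rel y z | adjacent C y z && (eps y (+) eps z == (0 < C y z))]
      (fun y z => a y z <= -1) by move=> y z /andP[]; apply: aN1.
  case: s ics even epsE => // x p _ _ epsE c1; apply: (sub_path sub).
  by rewrite path_relI; apply/andP.
have := gram_cycle aC axx a0 ics cyc.
have us := induced_cycle_uniq ics.
have := Cpos (fun i => if i \in s then w i else 0); rewrite /quad_form.
have -> : \sum_(y <- s) \sum_(z <- s) a y z =
    quad_form d C (fun i => if i \in s then w i else 0).
  rewrite big_uniq //= big_mkcond; apply: eq_bigr => i _.
  case: ifP => _; last by rewrite big1 // => j _; rewrite mulr0 mul0r.
  rewrite big_uniq //= big_mkcond; apply: eq_bigr => j _.
  by case: ifP => _; rewrite ?mulr0.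
rewrite /quad_form => /[swap]; rewrite leNgt => /negP h1 h2; case: h1; apply: h2.
case: s {even epsE cyc us} ics => // x p _; exists x; rewrite mem_head.
by rewrite mulf_neq0 ?signr_eq0 ?invr_eq0 ?lt0r_neq0.
Qed.

Section QuadForm.
Variables (R : rcfType) (n : nat) (d : 'I_n -> nat) (C : 'I_n -> 'I_n -> int).
Hypothesis Csym : symmetrizable_by d C.

Let dC i j : (d i)%:R * (C i j)%:~R = (d j)%:R * (C j i)%:~R :> R :=
  symE_ring Csym R i j.

(** The two cross terms are equal by symmetrizability, and the square has coefficient d_k C_kk = 2
    d_k. This serves both for test vectors and for the change of basis of a mutation. *)
Lemma quad_form_shift k (c : R) (x : 'I_n -> R) :
  quad_form d C (fun i => x i - (i == k)%:R * c) =
  quad_form d C x + 2 * (d k)%:R * (c * (c - \sum_j (C k j)%:~R * x j)).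
Proof.
have sumk (f : 'I_n -> R) : \sum_i (i == k)%:R * f i = f k.
  by rewrite (bigD1 k) //= eqxx mul1r big1 ?addr0 // => i /negPf ->; rewrite mul0r.
have -> : quad_form d C (fun i => x i - (i == k)%:R * c) = quad_form d C x
    - c * (\sum_i \sum_j (i == k)%:R * ((d i)%:R * (C i j)%:~R * x j))
    - c * (\sum_i \sum_j (j == k)%:R * ((d i)%:R * (C i j)%:~R * x i))
    + c ^+ 2 * (\sum_i \sum_j (i == k)%:R * ((j == k)%:R * ((d i)%:R * (C i j)%:~R))).
  rewrite /quad_form !mulr_sumr -!sumrB -big_split; apply: eq_bigr => i _.
  rewrite !mulr_sumr -!sumrB -big_split; apply: eq_bigr => j _ /=; ring.
under [X in _ - c * X - _ + _]eq_bigr do rewrite -mulr_sumr.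
under [X in _ - _ - c * X + _]eq_bigr do rewrite sumk dC.
under [X in _ - _ - _ + _ * X]eq_bigr do rewrite -mulr_sumr sumk.
rewrite !sumk (sym_diag Csym).
under [X in _ - c * X - _ + _]eq_bigr do rewrite -mulrA.
under [X in _ - _ - c * X + _]eq_bigr do rewrite -mulrA.
by rewrite -mulr_sumr -[2%:~R]/(2 : R); ring.
Qed.

End QuadForm.

Lemma positive_mul_lt4 (R : rcfType) n d (C : 'I_n -> 'I_n -> int) i j :
  positive_by R d C -> i != j -> C i j * C j i < 4.
Proof.
move=> [Csym Cpos] ij.
have d_gt0 l : 0 < (d l)%:R :> R by rewrite ltr0n (sym_gt0 Csym).
have dC : (d i)%:R * (C i j)%:~R = (d j)%:R * (C j i)%:~R :> R.
  exact: symE_ring.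
(* The test vector is 2 e_i - C_ji e_j, of value 2 d_i (4 - C_ij C_ji), built from 0 by two
   shifts. *)
pose c : R := (C j i)%:~R.
have := Cpos (fun l => (fun l => 0 - (l == i)%:R * (- 2)) l - (l == j)%:R * c).
rewrite (quad_form_shift Csym) (quad_form_shift Csym).
have -> : quad_form d C (fun=> 0 : R) = 0.
  by rewrite /quad_form big1 // => a _; rewrite big1 // => b _; rewrite mulr0.
rewrite [X in _ * (_ - X)]big1 => [|l _]; last by rewrite mulr0.
rewrite (bigD1 i) //= eqxx [X in _ * (_ - (_ + X))]big1 => [|l /negPf ->]; last first.
  by rewrite mul0r subr0 mulr0.
rewrite -/c => H; rewrite -(ltr_int R) rmorphM /= -/c.
suff : 0 < (d i)%:R * (4 - (C i j)%:~R * c) by rewrite pmulr_rgt0 // subr_gt0.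
have -> : (d i)%:R * (4 - (C i j)%:~R * c) = 4 * (d i)%:R - (d j)%:R * c * c.
  by rewrite -dC; ring.
have : 0 < 2 * (4 * (d i)%:R - (d j)%:R * c * c); last by rewrite pmulr_rgt0.
suff <- : 0 + 2 * (d i)%:R * (- 2 * (- 2 - 0)) +
    2 * (d j)%:R * (c * (c - (c * (0 - 1 * - 2) + 0)))
    = 2 * (4 * (d i)%:R - (d j)%:R * c * c).
  by apply: H; exists i; rewrite eqxx (negPf ij) mul1r mul0r subr0 sub0r opprK pnatr_eq0.
by ring.
Qed.

(** * Mutation of oriented positive companions *)

Section Mutation.
Variables (R : rcfType) (n : nat).
Implicit Types (U C : 'I_n -> 'I_n -> int) (i j k x y : 'I_n) (s t : seq 'I_n).

Definition skew_by (d : 'I_n -> nat) U : Prop :=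
  (forall i, (0 < d i)%N) /\ forall i j, (d i)%:Z * U i j = - ((d j)%:Z * U j i).

(** The boolean fixes the direction of travel, so that the paths i -> k -> j and i <- k <- j are
    treated at once. *)
Definition flow b U : rel 'I_n := fun i j => if b then 0 < U i j else U i j < 0.

Definition oriented U s : Prop := exists b, cycle (flow b U) s.

(* U stands for the value of a gss matrix at t = 1, and C for its Cartan
   counterpart; there is an arrow i -> j exactly when 0 < U i j. *)
Record finite_type d U C : Prop := {
  ft_pos : positive_by R d C;
  ft_skew : skew_by d U;
  ft_abs : forall i j, i != j -> `|C i j| = `|U i j|;
  ft_cycle : forall s, induced_cycle (adjacent C) s -> oriented U s }.

Definition mutU k U i j : int :=
  if (i == k) || (j == k) then - U i j
  else if 0 < U i k * U k j then U i j + sgz (U i k) * (U i k * U k j)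
  else U i j.

(* The Gram matrix of the basis obtained by reflecting along k the simple roots
   i with an arrow i -> k. *)
Definition mutC k U C i j : int :=
  C i j - (if (0 < U i k) (+) (0 < U j k) then C i k * C k j else 0).

Lemma skew_sgz d U i j : skew_by d U -> sgz (U i j) = - sgz (U j i).
Proof.
case=> d_gt0 /(_ i j) /(congr1 (@sgz _)); rewrite sgzN !sgzM.
by rewrite [sgz (d i)%:Z]gtr0_sgz 1?[sgz (d j)%:Z]gtr0_sgz ?ltz_nat // !mul1r.
Qed.

Lemma skew_lt0 d U i j : skew_by d U -> (U i j < 0) = (0 < U j i).
Proof. by move=> Us; rewrite -sgz_lt0 (skew_sgz _ _ Us) oppr_lt0 sgz_gt0. Qed.

Lemma skew_diag d U i : skew_by d U -> U i i = 0.
Proof. by move=> Us; apply/eqP; rewrite -sgz_eq0; have := skew_sgz i i Us; lia. Qed.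

Lemma flow_sym d U b i j : skew_by d U -> flow b U i j = flow (~~ b) U j i.
Proof.
move=> Us; case: b; rewrite /flow /=; first by rewrite (skew_lt0 _ _ Us).
exact: (skew_lt0 _ _ Us).
Qed.

Lemma flow_inj U b b' i j : flow b U i j -> flow b' U i j -> b = b'.
Proof. by case: b b' => [] [] //=; rewrite /flow; lia. Qed.

(** The equation is the symmetrizer identity around a triangle. If y >= 2 then x <= 1 <= p q; if y =
    1 then p q = r s x, which is at least x. *)
Lemma triangle_weight (x y p q r s : int) : 1 <= y -> 1 <= p -> 1 <= q ->
  1 <= r -> 1 <= s -> x * y < 4 -> p * q * y = r * s * x -> x <= p * q.
Proof.
move=> y1 p1 q1 r1 s1 xy4 E.
have pq1 : 1 <= p * q by nia.
have rs1 : 1 <= r * s by nia.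
move: (p * q) (r * s) pq1 rs1 E => m l m1 l1 E.
have [y2|y2] := ltP y 2; last first.
  have x2 : x < 2 by nia.
  lia.
have yE : y = 1 by lia.
move: E; rewrite yE mulr1 => mE.
have x0 : 0 < x by nia.
nia.
Qed.

(** Here [w] stands for U_xk U_ky, [p] for C_xk C_ky, and [u], [c] for the entries at x, y of a
    triangle through k. As [c] has the sign of [p] and [u] opposes the term added to it, both
    results have absolute value |p| - |c|. *)
Lemma triangle_mutation (b : bool) (p w c u : int) :
  0 < w -> `|p| = `|w| -> (if ~~ b then 0 < u else u < 0) ->
  `|c| = `|u| -> `|c| <= `|p| -> sgz c = sgz p ->
  let u' := u + (if b then 1 else -1) * w in
  [/\ `|c - p| = `|u'|, u' != 0 -> (if b then 0 < u' else u' < 0)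
    & c - p != 0 -> (0 < c - p) = ~~ (0 < c)].
Proof.
move=> w_gt0 pw; have {pw}wE : w = `|p| by lia.
rewrite wE; case: b => /=; case: (sgzP c) => c0; case: (sgzP p) => p0; split; lia.
Qed.

Lemma mutU_skew d U k : skew_by d U -> skew_by d (mutU k U).
Proof.
move=> Us; have [d_gt0 dU] := Us; split=> // i j; rewrite /mutU orbC.
case: ifP => _; first by have := dU i j; rewrite !mulrN; lia.
have E : (d i)%:Z * (U i k * U k j) = (d j)%:Z * (U j k * U k i).
  transitivity ((d i)%:Z * U i k * U k j); first by ring.
  rewrite dU; transitivity (- ((d k)%:Z * U k j) * U k i); first by ring.
  by rewrite dU; ring.
rewrite -[0 < U i k * _]sgz_gt0 -[0 < U j k * _]sgz_gt0 !sgzM.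
rewrite (skew_sgz k j Us) (skew_sgz k i Us) !mulrN.
rewrite [sgz (U j k) * sgz (U i k)]mulrC; case: ifP => // s_gt0.
have -> : sgz (U j k) = - sgz (U i k).
  by move: s_gt0; case: sgzP; case: sgzP.
by rewrite mulrDr dU mulrCA E; ring.
Qed.

(** * One mutation step at a vertex k *)

Section Step.
Variables (d : 'I_n -> nat) (U C : 'I_n -> 'I_n -> int) (k : 'I_n).
Hypothesis ft : finite_type d U C.

Local Notation U' := (mutU k U).
Local Notation C' := (mutC k U C).
Local Notation into i := (0 < U i k).

Let Cpos : positive_by R d C := ft_pos ft.
Let Csym : symmetrizable_by d C := Cpos.1.
Let Uskew : skew_by d U := ft_skew ft.
Let Ukk : U k k = 0 := skew_diag k Uskew.

Let adjC : symmetric (adjacent C) := adjacent_sym Csym.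

Lemma adjacent_flow i j : adjacent C i j = (i != j) && (U i j != 0).
Proof.
rewrite /adjacent; case: eqP => //= /eqP ij.
by rewrite -normr_eq0 (ft_abs ft) // normr_eq0.
Qed.

Lemma flow_into i : adjacent C i k -> flow (into i) U i k.
Proof. by rewrite adjacent_flow /flow => /andP[_]; case: ltrgtP. Qed.

Lemma flow_outof i : adjacent C k i -> flow (~~ into i) U k i.
Proof. by rewrite adjC => /flow_into; rewrite (flow_sym _ _ _ Uskew). Qed.

Lemma mutC_sym : symmetrizable_by d C'.
Proof.
split=> [|i j|i]; rewrite ?(sym_gt0 Csym) //; first exact: sym_gt0 Csym.
  rewrite /mutC addbC; case: ifP => _; last by rewrite !subr0 (symE Csym).
  rewrite !mulrBr (symE Csym i j); congr (_ - _).
  by rewrite !mulrA (symE Csym i k) (symE Csym j k) mulrAC (symE Csym k j) mulrAC.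
by rewrite /mutC addbb subr0 (sym_diag Csym).
Qed.

Let adjC' : symmetric (adjacent C') := adjacent_sym mutC_sym.

Lemma mutC_pos : positive_by R d C'.
Proof.
split=> [|x [l xl]]; first exact: mutC_sym.
(* The vector with coordinates [x] in the reflected basis has coordinates x_i - [i = k] c in the old
   one. *)
pose c : R := \sum_j (into j)%:R * (C k j)%:~R * x j.
have dC i j : (d i)%:R * (C i j)%:~R = (d j)%:R * (C j i)%:~R :> R.
  exact: symE_ring.
have -> : quad_form d C' x = quad_form d C (fun i => x i - (i == k)%:R * c).
  rewrite (quad_form_shift Csym) /quad_form mulrBr.
  have -> : 2 * (d k)%:R * (c * c - c * \sum_j (C k j)%:~R * x j) =
      - ((d k)%:R * (c * \sum_j (C k j)%:~R * x j + (\sum_j (C k j)%:~R * x j) * c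
           - 2 * (c * c))) by ring.
  rewrite /c !big_distrlr /= [2 * _]mulr_sumr -big_split -sumrB mulr_sumr -sumrN -big_split.
  apply: eq_bigr => i _ /=.
  rewrite [2 * _]mulr_sumr -big_split -sumrB mulr_sumr -sumrN -big_split.
  apply: eq_bigr => j _ /=.
  have -> : (C' i j)%:~R =
      (C i j)%:~R - ((into i)%:R + (into j)%:R - 2 * ((into i)%:R * (into j)%:R))
       * ((C i k)%:~R * (C k j)%:~R) :> R.
    rewrite /mutC rmorphB /=; congr (_ - _).
    by case: (into i); case: (into j) => /=; rewrite ?rmorphM /=; ring.
  have -> : (d k)%:R * ((into i)%:R * (C k i)%:~R * x i * ((C k j)%:~R * x j) +
     (C k i)%:~R * x i * ((into j)%:R * (C k j)%:~R * x j) -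
     2 * ((into i)%:R * (C k i)%:~R * x i * ((into j)%:R * (C k j)%:~R * x j))) =
     (d k)%:R * (C k i)%:~R * ((into i)%:R * x i * ((C k j)%:~R * x j) +
     x i * ((into j)%:R * (C k j)%:~R * x j) -
     2 * ((into i)%:R * x i * ((into j)%:R * (C k j)%:~R * x j))) :> R by ring.
  by rewrite [(d k)%:R * (C k i)%:~R]dC; ring.
apply: Cpos.2.
(* The change of basis is injective: it fixes the coordinates off k, and [c] involves only those,
   since k has no loop. *)
have [/existsP[j /andP[jk xj]]|/existsPn none] := boolP [exists j, (j != k) && (x j != 0)].
  by exists j; rewrite (negPf jk) mul0r subr0.
have x0 j : j != k -> x j = 0.
  by move=> jk; have := none j; rewrite jk negbK => /eqP.
have lk : l = k by apply/eqP; apply: contraNT xl => /x0 ->.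
rewrite lk in xl; exists k; rewrite eqxx mul1r /c big1 ?subr0 //= => j _.
have [->|/x0 ->] := eqVneq j k; last by rewrite mulr0.
by rewrite Ukk ltxx !mul0r.
Qed.

Lemma mutC_k i : adjacent C' k i = adjacent C k i.
Proof.
rewrite /adjacent /mutC Ukk ltxx /= (sym_diag Csym).
case: ifP => // _; congr (_ && ~~ _); lia.
Qed.

(** Both correction terms vanish unless one of [x], [y] has an arrow into k and the other an arrow
    out of k. *)
Lemma mut_unaffected x y : x != k -> y != k ->
  ~~ [&& adjacent C k x, adjacent C k y & into x (+) into y] ->
  C' x y = C x y /\ U' x y = U x y.
Proof.
move=> xk yk; rewrite /mutC /mutU (negPf xk) (negPf yk) /= => H.
have [adx|nadx] := boolP (adjacent C k x); last first.
  have : U x k = 0.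
    by move: nadx; rewrite adjC adjacent_flow xk /= negbK => /eqP.
  have : C x k = 0 by move: nadx; rewrite adjC /adjacent xk /= negbK => /eqP.
  by move=> -> ->; rewrite !mul0r ltxx if_same subr0.
have [ady|nady] := boolP (adjacent C k y); last first.
  have : U k y = 0.
    by move: nady; rewrite adjacent_flow eq_sym yk /= negbK => /eqP.
  have : C k y = 0 by move: nady; rewrite /adjacent eq_sym yk /= negbK => /eqP.
  by move=> -> ->; rewrite !mulr0 ltxx if_same subr0.
move: H; rewrite adx ady /= => /negbTE H; rewrite H subr0; split=> //.
move: H; rewrite -[0 < U x k * _]sgz_gt0 sgzM (skew_sgz k y Uskew).
by case: sgzP; case: sgzP.
Qed.

(** The triangle k, x, y is a chordless cycle: its cyclic orientation gives the flow, the odd number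
    of positive entries gives the sign, and [triangle_weight] gives the bound. *)
Lemma triangle_flow b x y : adjacent C x y -> adjacent C x k ->
  flow b U x k -> flow b U k y ->
  [/\ flow b U y x, sgz (C x y) = sgz (C x k * C k y)
    & `|C x y| <= `|C x k * C k y|].
Proof.
move=> xy xk fxk fky.
have xNy : x != y by case/andP: xy.
have kx : adjacent C k x by rewrite adjC.
have kNx : k != x by case/andP: kx.
have kNy : k != y.
  by apply: contraTneq fky => <-; rewrite /flow Ukk ltxx if_same.
have ky : adjacent C k y.
  by rewrite adjacent_flow kNy; move: fky; rewrite /flow; case: (b); case: ltrgtP.
have ics : induced_cycle (adjacent C) (k :: x :: rcons [::] y).
  by rewrite induced_cycleE /= !inE !andbT xy kx ky negb_or kNx kNy xNy.
have [b' /= /and4P[fkx fxy fyk _]] := ft_cycle ft ics.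
have par := positive_cycle_parity Cpos ics.
have b'E : b' = ~~ b.
  by move: fkx; rewrite (flow_sym _ _ _ Uskew) => /(flow_inj fxk) ->; rewrite negbK.
split.
- by rewrite (flow_sym _ _ _ Uskew) -b'E.
- move: par; rewrite /= addbF [0 < C y k](companion_gt0 Csym) [0 < C k x](companion_gt0 Csym).
  move: xy xk ky => /andP[_ +] /andP[_ +] /andP[_ +]; rewrite sgzM.
  by case: sgzP; case: sgzP; case: sgzP.
- have l1 := positive_mul_lt4 Cpos xNy.
  have l2 := companion_mul_ge1 Csym xy.
  have l3 := companion_mul_ge1 Csym xk.
  have l4 := companion_mul_ge1 Csym ky.
  have E : C x k * C k y * C y x = C k x * C y k * C x y.
    have dN0 l : (d l)%:Z != 0 by rewrite eqz_nat -lt0n (sym_gt0 Csym).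
    apply: (mulfI (dN0 x)); apply: (mulfI (dN0 k)); apply: (mulfI (dN0 y)).
    transitivity (((d x)%:Z * C x k) * ((d k)%:Z * C k y) * ((d y)%:Z * C y x)); first by ring.
    by rewrite (symE Csym x k) (symE Csym k y) (symE Csym y x); ring.
  have := congr1 (@Num.norm _ _) E; rewrite !normrM => absE.
  have ge1 (p q : int) : 1 <= p * q -> 1 <= `|p| /\ 1 <= `|q|.
    rewrite -!gtz0_ge1 !normr_gt0 => pq.
    by split; apply: contraTneq pq => ->; rewrite ?mul0r ?mulr0.
  have [xk1 kx1] := ge1 _ _ l3; have [ky1 yk1] := ge1 _ _ l4.
  have [_ yx1] := ge1 _ _ l2.
  have : `|C x y| * `|C y x| < 4 by rewrite -normrM ger0_norm // (le_trans _ l2).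
  by move=> xy4; exact: triangle_weight yx1 xk1 ky1 kx1 yk1 xy4 absE.
Qed.

(** If [x] and [y] are joined, the triangle with k bounds the old weight by the term added, so
    whatever survives is reversed; otherwise mutation creates an edge along the path through k. *)
Lemma mut_affected b x y : x != y -> flow b U x k -> flow b U k y ->
  [/\ `|C' x y| = `|U' x y|,
      adjacent C' x y -> flow b U' x y,
      adjacent C x y -> flow b U y x,
      adjacent C x y -> adjacent C' x y -> (0 < C' x y) = ~~ (0 < C x y)
    & ~~ adjacent C x y -> adjacent C' x y].
Proof.
move=> xy fxk fky.
have kNx : x != k.
  by apply: contraTneq fxk => ->; rewrite /flow Ukk ltxx if_same.
have kNy : k != y.
  by apply: contraTneq fky => <-; rewrite /flow Ukk ltxx if_same.
have xk : adjacent C x k.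
  by rewrite adjacent_flow kNx; move: fxk; rewrite /flow; case: (b); case: ltrgtP.
have prodE : `|C x k * C k y| = `|U x k * U k y|.
  by rewrite !normrM !(ft_abs ft).
have w_gt0 : 0 < U x k * U k y.
  by move: fxk fky; rewrite /flow; case: (b) => ? ?; nia.
have sE : sgz (U x k) = if b then 1 else -1.
  by move: fxk; rewrite /flow; case: (b); case: sgzP.
have C'E : C' x y = C x y - C x k * C k y.
  rewrite /mutC; suff -> : (0 < U x k) (+) (0 < U y k) by [].
  rewrite -(skew_lt0 k y Uskew); move: fxk fky; rewrite /flow.
  by case: (b) => f1 f2; rewrite ?f1 ?f2 ?(lt_gtF f1) ?(lt_gtF f2).
have U'E : U' x y = U x y + (if b then 1 else -1) * (U x k * U k y).
  by rewrite /mutU (negPf kNx) eq_sym (negPf kNy) /= w_gt0 sE.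
have [axy|naxy] := boolP (adjacent C x y).
  have [fyx sgE le] := triangle_flow axy xk fxk fky.
  have := fyx; rewrite (flow_sym _ _ _ Uskew) => fxy.
  have absE := ft_abs ft xy.
  have [absE' flowE signE] :=
    triangle_mutation (b := b) w_gt0 prodE fxy absE le sgE.
  rewrite /adjacent xy C'E /flow U'E; split=> //= C'0.
  by apply: flowE; rewrite -normr_eq0 -absE' normr_eq0.
have c0 : C x y = 0 by move: naxy; rewrite /adjacent xy negbK => /eqP.
have u0 : U x y = 0 by move: naxy; rewrite adjacent_flow xy negbK => /eqP.
have absE' : `|C' x y| = `|U' x y|.
  by rewrite C'E U'E c0 u0 sub0r add0r normrN prodE; case: (b); rewrite ?mulN1r ?mul1r ?normrN.
split=> //.
  by move=> _; rewrite /flow U'E u0 add0r; case: (b) => /=; lia.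
by rewrite /adjacent xy -normr_eq0 absE' normr_eq0 U'E u0 add0r; case: (b); lia.
Qed.

Lemma mut_abs i j : i != j -> `|C' i j| = `|U' i j|.
Proof.
move=> ij; have [ik|ik] := eqVneq i k.
  rewrite ik /mutC /mutU eqxx /= Ukk ltxx /= normrN -(ft_abs ft) -?ik //.
  by rewrite ik (sym_diag Csym); case: ifP; lia.
have [jk|jk] := eqVneq j k.
  rewrite jk /mutC /mutU eqxx orbT /= Ukk ltxx addbF normrN -(ft_abs ft) -?jk //.
  by rewrite jk (sym_diag Csym); case: ifP; lia.
have [/and3P[ki kj]|H] :=
  boolP [&& adjacent C k i, adjacent C k j & into i (+) into j]; last first.
  by have [-> ->] := mut_unaffected ik jk H; exact: ft_abs ft _ _ ij.
move=> H; have [] // := @mut_affected (into i) i j ij.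
  by apply: flow_into; rewrite adjC.
by have := flow_outof kj; move: H; case: (into i); case: (into j).
Qed.

Lemma mut_flow_k b i : flow b U' k i = flow (~~ b) U k i.
Proof. by rewrite /flow /mutU eqxx /=; case: b => /=; lia. Qed.

(** On such a cycle only [u] and [v] are neighbours of k. If both lay on the same side, the cycle
    would, apart from signs at k, be the same for [C], hence chordless there; but then it could not
    be oriented through k. *)
Lemma mut_into_neq u t v : induced_cycle (adjacent C') (k :: u :: rcons t v) ->
  into u != into v.
Proof.
move=> ics'; apply/negP => /eqP uv.
have := ics'; rewrite induced_cycleE => /and5P[_ _ ku kv kt].
have ics : induced_cycle (adjacent C) (k :: u :: rcons t v).
  apply: eq_in_induced_cycle ics' => x y xs ys.
  have [->|xk] := eqVneq x k; first by rewrite mutC_k.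
  have [->|yk] := eqVneq y k; first by rewrite adjC' adjC mutC_k.
  have intoE z : z \in k :: u :: rcons t v -> z != k -> adjacent C k z -> into z = into u.
    rewrite !inE mem_rcons inE => /or4P[/eqP ->|/eqP ->|/eqP ->|zt] //.
      by rewrite eqxx.
    by rewrite -mutC_k (negPf (allP kt _ zt)).
  rewrite /adjacent; have [] // := @mut_unaffected x y; last by move=> ->.
  by apply/and3P=> -[kx ky]; rewrite (intoE x) // (intoE y) // addbb.
have [b /= /andP[fku]] := ft_cycle ft ics; rewrite rcons_path last_rcons.
case/andP=> _; rewrite (flow_sym _ _ _ Uskew) => fkv.
rewrite !mutC_k in ku kv.
have := flow_inj fku (flow_outof ku); have := flow_inj fkv (flow_outof kv).
by rewrite uv => <- /eqP; rewrite eq_sym; case: (b).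
Qed.

Lemma flow_unaffected b x y : x != k -> y != k ->
  ~~ [&& adjacent C k x, adjacent C k y & into x (+) into y] ->
  flow b U' x y = flow b U x y.
Proof. by move=> xk yk H; rewrite /flow; have [_ ->] := mut_unaffected xk yk H. Qed.

Lemma adjacent_unaffected x y : x != k -> y != k ->
  ~~ [&& adjacent C k x, adjacent C k y & into x (+) into y] ->
  adjacent C' x y = adjacent C x y.
Proof. by move=> xk yk H; rewrite /adjacent; have [-> _] := mut_unaffected xk yk H. Qed.

Lemma oriented_rot m V s : oriented V (rot m s) -> oriented V s.
Proof. by case=> b; rewrite rot_cycle; exists b. Qed.

Lemma unaffected_path u t v :
  all (fun z => ~~ adjacent C k z) t ->
  {in rcons t v &, forall x y,
    ~~ [&& adjacent C k x, adjacent C k y & into x (+) into y]} /\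
  {in t, forall x, ~~ [&& adjacent C k u, adjacent C k x & into u (+) into x]}.
Proof.
move=> kt; split=> [x y|x xt]; last by rewrite (negPf (allP kt _ xt)) andbF.
rewrite !mem_rcons !inE => /predU1P[->|/(allP kt)/negPf ->]; last by [].
by case/predU1P=> [->|/(allP kt)/negPf ->]; rewrite ?addbb ?andbF.
Qed.

(** For nonempty [t], the ends [u] and [v] are not joined after mutation, so they were joined
    before. Then [u], [t], [v] is a chordless cycle of [C], and its orientation carries over, the
    path through k replacing the arrow between [u] and [v]. *)
Lemma oriented_mut_through u t v :
  induced_cycle (adjacent C') (k :: u :: rcons t v) ->
  oriented U' (k :: u :: rcons t v).
Proof.
move=> ics'; have uv := mut_into_neq ics'.
move: ics'; rewrite induced_cycleE => /and5P[uniq_s path_s].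
rewrite !mutC_k => ku kv kt.
have kNs : k \notin u :: rcons t v by move: uniq_s; rewrite cons_uniq => /andP[].
have kNx x : x \in u :: rcons t v -> x != k by apply: contraTneq => ->.
have {}kt : all (fun z => ~~ adjacent C k z) t.
  by apply/allP => z /(allP kt); rewrite mutC_k.
have [un1 un2] := unaffected_path u v kt.
have uNv : u != v.
  by move: uniq_s => /= /and3P[_ + _]; rewrite mem_rcons inE negb_or => /andP[].
pose b := into u.
have fuk : flow b U u k by apply: flow_into; rewrite adjC.
have fkv : flow b U k v.
  by have := flow_outof kv; rewrite /b; move: uv; case: (into u); case: (into v).
have [_ f1 f2 _ f4] := mut_affected uNv fuk fkv.
exists b; rewrite /= rcons_path last_rcons mut_flow_k -(flow_sym _ _ _ Uskew) fuk /=.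
rewrite (flow_sym _ _ _ (mutU_skew k Uskew)) mut_flow_k negbK fkv andbT.
case: t => [|t0 t] in uniq_s path_s kt kNs kNx un1 un2 *.
  by move: path_s => /= /andP[/f1 ->].
have mt x : x \in rcons (t0 :: t) v -> x \in u :: rcons (t0 :: t) v.
  by move=> xin; rewrite in_cons xin orbT.
have nuv : ~~ adjacent C' u v.
  by move: path_s => /= /and3P[_ + _]; rewrite all_rcons => /andP[].
have auv : adjacent C u v by apply: contraNT nuv => /f4.
have uNk : u != k by rewrite kNx ?mem_head.
have t0Nk : t0 != k by rewrite kNx // mt ?mem_head.
have ics : induced_cycle (adjacent C) (u :: t0 :: rcons t v).
  rewrite induced_cycleE; apply/and5P; split=> //.
  - by move: uniq_s => /andP[].
  - move: path_s => /= /and3P[_ _ I].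
    rewrite -(@eq_in_induced_path _ (adjacent C')) // => x y xs ys.
    by apply: adjacent_unaffected; [exact/kNx/mt|exact/kNx/mt|exact: un1].
  - rewrite -adjacent_unaffected ?uNk ?t0Nk ?un2 ?mem_head //.
    by move: path_s => /= /and3P[].
  - apply/allP => z zt; rewrite -adjacent_unaffected.
    + by move: path_s => /= /and3P[_ + _]; rewrite all_rcons => /andP[_ /allP/(_ z zt)].
    + exact: uNk.
    + by apply: kNx; rewrite !inE mem_rcons inE zt !orbT.
    + by apply: un2; rewrite inE zt orbT.
have [b' /=] := ft_cycle ft ics; rewrite rcons_path last_rcons => /and3P[fut0 ft0v fvu].
have b'E : b' = b by apply: flow_inj fvu _; exact: f2.
rewrite b'E in fut0 ft0v; apply/andP; split.
  by rewrite flow_unaffected ?uNk ?t0Nk ?un2 ?mem_head.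
have fE : {in mem (rcons (t0 :: t) v) &, flow b U =2 flow b U'}.
  move=> x y xs ys.
  by rewrite flow_unaffected //; [exact/kNx/mt|exact/kNx/mt|exact: un1].
by rewrite -(eq_in_path fE) //; apply/allP.
Qed.

(** If [u] and [v] were already joined, the cycle is chordless for [C] too, and the sign change of
    this single edge contradicts odd parity before and after. Otherwise the cycle through k was
    chordless and oriented, and the new arrow bypasses k. *)
Lemma oriented_mut_chord u t v :
  induced_cycle (adjacent C') (u :: rcons t v) -> k \notin u :: rcons t v ->
  adjacent C k u -> adjacent C k v -> all (fun z => ~~ adjacent C k z) t ->
  into u != into v -> oriented U' (u :: rcons t v).
Proof.
move=> ics' kNs ku kv kt uv.
have [un1 un2] := unaffected_path u v kt.
have kNx x : x \in u :: rcons t v -> x != k by apply: contraTneq => ->.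
case: t => [|t0 t] in ics' kNs kt kNx un1 un2 *.
  by move: ics' => /and3P[].
have mt x : x \in rcons (t0 :: t) v -> x \in u :: rcons (t0 :: t) v.
  by move=> xin; rewrite in_cons xin orbT.
have mv : v \in rcons (t0 :: t) v by rewrite mem_rcons mem_head.
have uNv : u != v.
  have /= /and3P[+ _ _] := induced_cycle_uniq ics'.
  by rewrite inE mem_rcons inE !negb_or => /and3P[].
pose b := into u.
have fuk : flow b U u k by apply: flow_into; rewrite adjC.
have fkv : flow b U k v.
  by have := flow_outof kv; rewrite /b; move: uv; case: (into u); case: (into v).
have [_ f1 f2 f3 f4] := mut_affected uNv fuk fkv.
have fE b' x y : x \in rcons (t0 :: t) v -> y \in rcons (t0 :: t) v ->
    flow b' U' x y = flow b' U x y.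
  by move=> xs ys; rewrite flow_unaffected //; [exact/kNx/mt|exact/kNx/mt|exact: un1].
have aE x y : x \in rcons (t0 :: t) v -> y \in rcons (t0 :: t) v ->
    adjacent C' x y = adjacent C x y.
  by move=> xs ys; rewrite adjacent_unaffected //; [exact/kNx/mt|exact/kNx/mt|exact: un1].
have auE x : x \in t0 :: t -> adjacent C' u x = adjacent C u x.
  move=> xt; rewrite adjacent_unaffected ?un2 ?kNx ?mem_head //.
  by rewrite inE mem_rcons inE xt !orbT.
have := ics'; rewrite rcons_cons induced_cycleE.
case/and5P=> uniq_s path_s aut0 auv' aut.
have path_t : induced_path (adjacent C) t0 (rcons t v).
  by rewrite -(@eq_in_induced_path _ (adjacent C')) // => x y xs ys; exact: aE.
have t0in : t0 \in t0 :: t by exact: mem_head.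
have uNk : u != k by rewrite kNx ?mem_head.
have t0Nk : t0 != k by rewrite kNx // mt ?mem_head.
have aut0C : adjacent C u t0 by rewrite -auE.
have autC : all (fun z => ~~ adjacent C u z) t.
  by apply/allP => z zt; rewrite -auE ?(allP aut) // inE zt orbT.
have [auv|nauv] := boolP (adjacent C u v).
  have ics : induced_cycle (adjacent C) (u :: t0 :: rcons t v).
    by rewrite induced_cycleE uniq_s path_t aut0C auv.
  have := positive_cycle_parity Cpos ics.
  have := positive_cycle_parity mutC_pos ics'.
  rewrite [cycle_parity _ _]parity_rcons last_rcons => par'.
  rewrite [cycle_parity _ _]parity_rcons -rcons_cons last_rcons.
  move: par'; rewrite (companion_gt0 mutC_sym) (companion_gt0 Csym) f3 //.
  rewrite (_ : parity _ u _ = parity (fun x y => 0 < C x y) u (rcons (t0 :: t) v)).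
    by case: (parity _ u _); case: (0 < C u v).
  rewrite rcons_cons /=; congr (_ (+) _).
    by have [-> _] := mut_unaffected uNk t0Nk (un2 t0 t0in).
  apply: eq_in_parity => x y xs ys.
  by have [-> _] := mut_unaffected (kNx _ (mt _ xs)) (kNx _ (mt _ ys)) (un1 _ _ xs ys).
have ics : induced_cycle (adjacent C) (k :: u :: rcons (t0 :: t) v).
  rewrite induced_cycleE; apply/and5P; split=> //.
    by rewrite cons_uniq kNs; exact: induced_cycle_uniq ics'.
  by rewrite rcons_cons /= aut0C all_rcons nauv autC path_t.
have [b' /=] := ft_cycle ft ics.
rewrite rcons_path => /and4P[fku fut0 ft0v _].
have b'E : b' = ~~ b.
  by apply: (flow_inj fku); rewrite -(flow_sym _ _ _ Uskew).
exists b'; rewrite /= rcons_path last_rcons; apply/and3P; split.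
- by rewrite flow_unaffected ?un2.
- have fE' : {in mem (rcons (t0 :: t) v) &, flow b' U =2 flow b' U'}.
    by move=> x y xs ys; rewrite fE.
  by rewrite -(eq_in_path fE') //; apply/allP.
- by rewrite b'E -(flow_sym _ _ _ (mutU_skew k Uskew)); exact: f1.
Qed.

Lemma oriented_mut s : induced_cycle (adjacent C') s -> oriented U' s.
Proof.
move=> ics'; have [ks|kNs] := boolP (k \in s).
  have [m p E] := rot_to ks; apply: (@oriented_rot m); rewrite E.
  have := induced_cycle_rot m adjC' ics'; rewrite E => ics1.
  have [k0 [u [t [v E1]]]] := induced_cycle_split ics1.
  by case: E1 ics1 => _ -> /oriented_mut_through.
have kNx x : x \in s -> x != k by apply: contraTneq => ->.
have [/existsP[x /existsP[y /and5P[xs ys kx ky xy]]]|none] :=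
    boolP [exists x, exists y, [&& x \in s, y \in s, adjacent C k x,
             adjacent C k y & into x (+) into y]]; last first.
  have un : {in s &, forall x y,
      ~~ [&& adjacent C k x, adjacent C k y & into x (+) into y]}.
    move=> x y xs ys; apply: contra none => H.
    by apply/existsP; exists x; apply/existsP; exists y; rewrite xs ys.
  have ics : induced_cycle (adjacent C) s.
    apply: eq_in_induced_cycle ics' => x y xs ys.
    by apply: adjacent_unaffected; [exact: kNx|exact: kNx|exact: un].
  have [b cyc] := ft_cycle ft ics.
  have fE : {in mem s &, flow b U =2 flow b U'}.
    move=> x y xs ys.
    by rewrite flow_unaffected //; [exact: kNx|exact: kNx|exact: un].
  by exists b; rewrite -(eq_in_cycle fE) //; apply/allP.
have [m p E] := rot_to xs; apply: (@oriented_rot m).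
have := induced_cycle_rot m adjC' ics'.
have : k \notin rot m s by rewrite mem_rot.
have : y \in rot m s by rewrite mem_rot.
rewrite E => {E ics' kNs kNx xs} ys kNs ics' {m s}.
(* The first case says that k has exactly two neighbours on the cycle and that they are
   consecutive. *)
have [[m [u [t [v [E ku kv kt]]]]]|nchord] := pselect (exists m u t v,
    [/\ rot m (x :: p) = u :: rcons t v, adjacent C k u, adjacent C k v
      & all (fun z => ~~ adjacent C k z) t]).
  apply: (@oriented_rot m).
  have := induced_cycle_rot m adjC' ics'.
  have kE : k \notin rot m (x :: p) by rewrite mem_rot.
  have rotE z : z \in x :: p -> adjacent C k z -> z = u \/ z = v.
    rewrite -(mem_rot m) E inE mem_rcons inE => /or3P[/eqP ->|/eqP ->|/(allP kt)/negPf ->] //.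
    - by left.
    - by right.
  rewrite E in kE *; move/oriented_mut_chord; apply=> //.
  by case: (rotE x (mem_head _ _) kx) (rotE y ys ky) xy => -> [] -> /=;
    rewrite ?addbb //; case: (into u); case: (into v).
(* Between consecutive neighbours u, v of k the type [into] changes, so the parity
   of the segment is tau u + tau v; the total around the cycle would be even. *)
exfalso; have := positive_cycle_parity mutC_pos ics'; rewrite [cycle_parity _ _]/=.
rewrite (@parity_segments _ (adjacent C k) _ (fun z => into z (+) (0 < C' k z))) //.
- by rewrite last_rcons addbb.
- by rewrite last_rcons.
move=> q1 u t v q2 E2 ku kv kt.
suff [m [q E3]] : exists m q, rot m (x :: p) = u :: t ++ v :: q.
  (* By [nchord] something lies beyond the segment, so the segment closed up by k is a chordless
     cycle for [C']. *)
  have qN : q != [::].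
    by apply/eqP=> q0; apply: nchord; exists m, u, t, v; rewrite E3 q0 cats1.
  have ics3 := induced_cycle_rot m adjC' ics'; rewrite E3 in ics3.
  have sub : subseq (u :: rcons t v) (u :: t ++ v :: q).
    by rewrite -cat_rcons -cat_cons prefix_subseq.
  have kNK : k \notin u :: rcons t v.
    by apply: contra kNs => /(mem_subseq sub); rewrite -E3 mem_rot.
  have kt' : all (fun z => ~~ adjacent C' k z) t.
    by apply/allP => z /(allP kt) /=; rewrite mutC_k.
  have icsK : induced_cycle (adjacent C') (k :: u :: rcons t v).
    rewrite induced_cycleE !mutC_k ku kv (induced_cycle_arc adjC' qN ics3) kt'.
    by rewrite cons_uniq kNK (subseq_uniq sub (induced_cycle_uniq ics3)).
  have := mut_into_neq icsK.
  have := positive_cycle_parity mutC_pos icsK.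
  rewrite /= parity_rcons last_rcons (companion_gt0 mutC_sym v k).
  by case: (into u); case: (into v); case: (parity _ _ _);
    case: (0 < C' k u); case: (0 < C' k v).
(* An empty [q2] means that the segment ends at the repetition of the base vertex [x], so a rotation
   has to carry it across the base point. *)
case/lastP: q2 E2 => [|q2 z] E2.
  have : rcons (x :: p) x = rcons (q1 ++ u :: t) v.
    by rewrite rcons_cons E2 rcons_cat rcons_cons -cats1.
  move=> /rcons_inj[{}E2 vx].
  case: q1 E2 => [[ux pt]|z q1 [_ pE]].
    (* With [q1] empty as well, the segment is the whole cycle and [x] the only neighbour of k on
       it, against the choice of [y]. *)
    exfalso; move: ys; rewrite inE => /predU1P[yx|]; first by rewrite yx addbb in xy.
    by rewrite pt => /(allP kt) /=; rewrite ky.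
  exists (size q1).+1, q1.
  rewrite -vx pE -[x :: _ ++ _]cat_cons -[(size q1).+1]/(size (x :: q1)).
  by rewrite rot_size_cat.
have : rcons (x :: p) x = rcons (q1 ++ u :: t ++ v :: q2) z.
  by rewrite rcons_cons E2 rcons_cat rcons_cons rcons_cat rcons_cons.
move=> /rcons_inj[{}E2 _].
exists (size q1), (q2 ++ q1); rewrite E2 rot_size_cat /=.
by rewrite -catA.
Qed.

Theorem finite_type_mut : finite_type d U' C'.
Proof.
split; [exact: mutC_pos|exact: mutU_skew|exact: mut_abs|exact: oriented_mut].
Qed.

End Step.
End Mutation.

(** * Dynkin diagrams *)

(** With y = u / p and z = v / q this is 2 |y z| <= y^2 + z^2, scaled by |a| p q / 2. *)
Lemma amgm (R : realFieldType) (a u v p q : R) : 0 < p -> 0 < q ->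
  - (`|a| * (q / p) * u ^+ 2 / 2 + `|a| * (p / q) * v ^+ 2 / 2) <= a * u * v.
Proof.
move=> p0 q0; pose y := u / p; pose z := v / q.
have uE : u = y * p by rewrite /y mulfVK ?gt_eqF.
have vE : v = z * q by rewrite /z mulfVK ?gt_eqF.
have -> : `|a| * (q / p) * u ^+ 2 / 2 + `|a| * (p / q) * v ^+ 2 / 2 =
    p * q * (`|a| * (y ^+ 2 + z ^+ 2) / 2).
  by rewrite uE vE; field; rewrite !gt_eqF.
have -> : a * u * v = p * q * (a * (y * z)) by rewrite uE vE; ring.
rewrite -mulrN ler_pM2l ?mulr_gt0 //.
have := sqr_ge0 (y + z); have := sqr_ge0 (y - z); case: (ger0P a) => a0; nra.
Qed.

(** Rescaling the coordinates by [l] turns the hypothesis into strict diagonal dominance. Each cross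
    term is charged to the two diagonal entries as [b i j] and [b j i], and [y i] is what remains of
    the diagonal. *)
Lemma dominated_positive (R : rcfType) n d (C : 'I_n -> 'I_n -> int)
    (l : 'I_n -> nat) :
  symmetrizable_by d C -> (forall i, 0 < l i)%N ->
  (forall i, \sum_(j | j != i) `|C i j|%N * l j < 2 * l i)%N ->
  positive_by R d C.
Proof.
move=> Csym l_gt0 dom; split=> // x [i0 xi0].
have d_gt0 i : 0 < (d i)%:R :> R by rewrite ltr0n (sym_gt0 Csym).
have lR i : 0 < (l i)%:R :> R by rewrite ltr0n.
pose a i j : R := (d i)%:R * (C i j)%:~R.
have aC i j : a i j = a j i.
  exact: symE_ring.
pose b i j : R := `|a i j| * ((l j)%:R / (l i)%:R) * x i ^+ 2 / 2.
have bnd i j : - (b i j + b j i) <= a i j * x i * x j.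
  by rewrite /b [a j i]aC; apply: amgm.
pose m i : R := (2 * l i)%:R - \sum_(j | j != i) (`|C i j|%N * l j)%:R.
have m_gt0 i : 0 < m i by rewrite subr_gt0 -natr_sum ltr_nat.
pose y i : R := (d i)%:R / (l i)%:R * x i ^+ 2 * m i.
have y_ge0 i : 0 <= y i.
  apply: mulr_ge0; last exact: ltW.
  by apply: mulr_ge0; [apply: divr_ge0; exact: ltW|exact: sqr_ge0].
have : 0 < \sum_i y i.
  rewrite (bigD1 i0) //= ltr_pwDl ?sumr_ge0 //.
  apply: mulr_gt0 => //; apply: mulr_gt0; first by rewrite divr_gt0.
  by rewrite exprn_even_gt0.
move=> /lt_le_trans; apply.
have yE i : y i = 2 * (d i)%:R * x i ^+ 2 -
    \sum_(j | j != i) b i j - \sum_(j | j != i) b i j.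
  have -> : \sum_(j | j != i) b i j =
      (d i)%:R / (l i)%:R * x i ^+ 2 / 2 * \sum_(j | j != i) (`|C i j|%N * l j)%:R.
    rewrite mulr_sumr; apply: eq_bigr => j _; rewrite /b /a natrM normrM gtr0_norm //.
    have -> : `|(C i j)%:~R| = `|C i j|%N%:R :> R.
      by rewrite -intr_norm -abszE -pmulrn.
    by ring.
  by rewrite /y /m natrM; field; rewrite gt_eqF.
rewrite (eq_bigr _ (fun i _ => yE i)) !sumrB.
have bC : \sum_i \sum_(j | j != i) b i j = \sum_i \sum_(j | j != i) b j i.
  rewrite (exchange_big_dep xpredT) //=; apply: eq_bigr => i _.
  by apply: eq_bigl => j; rewrite eq_sym.
rewrite [X in _ - _ - X <= _]bC -!sumrB /quad_form; apply: ler_sum => i _.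
rewrite [leRHS](bigD1 i) //= (sym_diag Csym).
have -> : (d i)%:R * 2%:~R * x i * x i = 2 * (d i)%:R * x i ^+ 2 :> R.
  by rewrite -[2%:~R]/(2 : R); ring.
rewrite -addrA lerD2l -!sumrN -big_split; apply: ler_sum => j _ /=.
by have := bnd i j; rewrite opprD /a.
Qed.

Lemma parity0 (T : eqType) (e g : rel T) x p :
  (forall y z, e y z -> ~~ g y z) -> path e x p -> parity g x p = false.
Proof.
by move=> eg; elim: p x => //= y p IH x /andP[/eg/negPf -> /IH].
Qed.

(* Domination does not see the signs: with all entries nonpositive a chordless
   cycle would have an even number of positive edges. *)
Lemma dominated_finite_type (R : rcfType) n d (U C : 'I_n -> 'I_n -> int)
    (l : 'I_n -> nat) :
  symmetrizable_by d C -> skew_by d U ->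
  (forall i j, i != j -> `|C i j| = `|U i j|) -> (forall i, 0 < l i)%N ->
  (forall i, \sum_(j | j != i) `|C i j|%N * l j < 2 * l i)%N ->
  finite_type R d U C.
Proof.
move=> Csym Us CU l_gt0 dom; split=> //; first exact: dominated_positive dom.
pose C0 (i j : 'I_n) : int := if i == j then 2 else - `|C i j|.
have C0sym : symmetrizable_by d C0.
  split=> [i|i j|i]; rewrite ?(sym_gt0 Csym) /C0 ?eqxx // eq_sym.
  case: eqP => [->//|_]; rewrite !mulrN; congr (- _).
  have := congr1 (@Num.norm _ _) (symE Csym i j); rewrite !normrM.
  rewrite [`|(d i)%:Z|]ger0_norm // [`|(d j)%:Z|]ger0_norm //.
have C0pos : positive_by R d C0.
  apply: (@dominated_positive R n d C0 l) => // i.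
  rewrite (eq_bigr (fun j => `|C i j|%N * l j)%N) // => j ji.
  by rewrite /C0 eq_sym (negPf ji) abszN absz_id.
move=> s ics; exfalso.
have ics0 : induced_cycle (adjacent C0) s.
  apply: eq_in_induced_cycle ics => i j _ _; rewrite /adjacent /C0.
  by case: eqP => //= _; rewrite oppr_eq0 normr_eq0.
have := positive_cycle_parity C0pos ics0.
have := induced_cycle_cycle (adjacent_sym C0sym) ics0.
case: s {ics ics0} => // x p c; rewrite /cycle_parity (parity0 _ c) // => i j.
by rewrite /adjacent /C0; case: eqP => //= _; rewrite -leNgt oppr_le0.
Qed.

(** Elements of [S] outside the range count as 0, so a support such as [a.-1], [a.+1] needs no
    special care at the ends of a diagram. *)
Lemma sum_le_support n (f : nat -> nat) (S : seq nat) :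
  (forall b, b < n -> b \notin S -> f b = 0)%N ->
  (\sum_(b < n) f b <= \sum_(c <- S) if c < n then f c else 0)%N.
Proof.
move=> f0; apply: (@leq_trans (\sum_(b < n) \sum_(c <- S) (c == b) * f c)%N).
  apply: leq_sum => b _; have [bS|/(f0 _ (ltn_ord b)) -> //] := boolP (nat_of_ord b \in S).
  by rewrite (big_rem _ bS) /= eqxx mul1n leq_addr.
rewrite exchange_big /=; apply: leq_sum => c _.
case: ltnP => cn.
  rewrite (bigD1 (Ordinal cn)) //= eqxx mul1n big1 ?addn0 // => b bc.
  by rewrite eq_sym -[c]/(nat_of_ord (Ordinal cn)) val_eqE (negPf bc).
rewrite big1 // => b _; case: eqP => // cb.
by move: cn; rewrite cb leqNgt ltn_ord.
Qed.

(** The absolute value of the off-diagonal Cartan entry, recovered from the diagram: with at most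
    three edges one of the two entries of a bond is 1, so the entry at the larger vertex is the
    number of edges. *)
Definition dynkin_entry T (a b : nat) : nat :=
  if dynkin_larger T a b then dynkin_edges T a b else (0 < dynkin_edges T a b)%N.

(* A positive vector on which the Cartan matrix is positive; up to scaling these
   are the coordinates of the half sum of the positive roots or coroots. *)
Definition dynkin_label T (a : nat) : nat :=
  match T with
  | DynA n => a.+1 * (n - a)
  | DynB n => if a == n.-1 then n * n.+1 else 2 * (a.+1 * (2 * n - a))
  | DynC n => a.+1 * (2 * n - a)
  | DynD n => if n - 2 <= a then n.-1 * n.+2 else 2 * (a.+1 * (2 * n - a))
  | DynE _ => nth 0 [:: 92; 136; 182; 270; 220; 168; 114; 58] a
  | DynF4 => nth 0 [:: 16; 30; 21; 11] a
  | DynG2 => nth 0 [:: 3; 5] a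
  end%N.

Lemma dynkin_label_gt0 T a : dynkin_valid T -> (a < dynkin_rank T)%N ->
  (0 < dynkin_label T a)%N.
Proof.
case: T => [n|n|n|n|n||] /=.
- by move=> _ an; rewrite muln_gt0 subn_gt0.
- by move=> n1 an; case: eqP => _; rewrite !muln_gt0; lia.
- by move=> n1 an; rewrite muln_gt0; lia.
- by move=> n1 an; case: ifP => _; rewrite !muln_gt0; lia.
- case/andP=> _ n9 an; have : (a < 8)%N by lia.
  by move: a {an}; do 8 case=> //.
- by move: a; do 4 case=> //.
- by move: a; do 2 case=> //.
Qed.

Lemma dynkin_entry_chain (T : dynkin_type) a :
  match T with DynA _ | DynB _ | DynC _ => True | _ => False end ->
  forall b, b \notin [:: a.-1; a.+1] -> dynkin_entry T a b = 0%N.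
Proof.
move=> hT b; rewrite !inE negb_or => /andP[/eqP b1 /eqP b2].
rewrite /dynkin_entry; suff -> : dynkin_edges T a b = 0%N by rewrite if_same.
rewrite /dynkin_edges; case: T hT => [n|n|n|n|n||] //= _; case: ltngtP => // ab; lia.
Qed.

Lemma dynkin_edgesxx T a : dynkin_edges T a a = 0%N.
Proof. by rewrite /dynkin_edges ltnn. Qed.

Lemma dynkin_edgesSl T a : dynkin_edges T a a.+1 = dynkin_bond T a a.+1.
Proof. by rewrite /dynkin_edges ltnSn. Qed.

Lemma dynkin_edgesSr T a : dynkin_edges T a.+1 a = dynkin_bond T a a.+1.
Proof. by rewrite /dynkin_edges ltnSn ltnNge leqnSn. Qed.

Lemma dynkin_dominated_A n a : (a < n)%N ->
  (\sum_(b < n) dynkin_entry (DynA n) a b * dynkin_label (DynA n) b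
     < 2 * dynkin_label (DynA n) a)%N.
Proof.
move=> an; apply: (leq_ltn_trans (@sum_le_support n
  (fun b => dynkin_entry (DynA n) a b * dynkin_label (DynA n) b)%N [:: a.-1; a.+1] _)).
  by move=> b _ /(dynkin_entry_chain (T := DynA n) I) ->.
rewrite !big_cons big_nil /dynkin_entry.
case: a an => [|a] an; rewrite ?dynkin_edgesSr ?dynkin_edgesSl /= ?eqxx /=;
  do ! case: ifP => ? //=; nia.
Qed.

Lemma dynkin_dominated_B n a : (1 < n)%N -> (a < n)%N ->
  (\sum_(b < n) dynkin_entry (DynB n) a b * dynkin_label (DynB n) b
     < 2 * dynkin_label (DynB n) a)%N.
Proof.
move=> n1 an; apply: (leq_ltn_trans (@sum_le_support n
  (fun b => dynkin_entry (DynB n) a b * dynkin_label (DynB n) b)%N [:: a.-1; a.+1] _)).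
  by move=> b _ /(dynkin_entry_chain (T := DynB n) I) ->.
rewrite !big_cons big_nil /dynkin_entry.
case: a an => [|a] an; rewrite ?dynkin_edgesxx ?dynkin_edgesSr ?dynkin_edgesSl /= ?eqxx /=.
- do ? case: ifP => ?; nia.
- do ? case: ifP => ?; nia.
Qed.

Lemma dynkin_dominated_C n a : (2 < n)%N -> (a < n)%N ->
  (\sum_(b < n) dynkin_entry (DynC n) a b * dynkin_label (DynC n) b
     < 2 * dynkin_label (DynC n) a)%N.
Proof.
move=> n1 an; apply: (leq_ltn_trans (@sum_le_support n
  (fun b => dynkin_entry (DynC n) a b * dynkin_label (DynC n) b)%N [:: a.-1; a.+1] _)).
  by move=> b _ /(dynkin_entry_chain (T := DynC n) I) ->.
rewrite !big_cons big_nil /dynkin_entry.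
case: a an => [|a] an; rewrite ?dynkin_edgesxx ?dynkin_edgesSr ?dynkin_edgesSl /= ?eqxx /=.
- do ? case: ifP => ?; nia.
- do ? case: ifP => ?; nia.
Qed.

Lemma dynkin_dominated_D n a : (3 < n)%N -> (a < n)%N ->
  (\sum_(b < n) dynkin_entry (DynD n) a b * dynkin_label (DynD n) b
     < 2 * dynkin_label (DynD n) a)%N.
Proof.
(* With n = m + 4 the branch vertex is m + 1, and m + 2 and m + 3 are the two leaves attached to it;
   below it the diagram is a chain. *)
case: n => [|[|[|[|m]]]] // _ an.
pose f b := (dynkin_entry (DynD m.+4) a b * dynkin_label (DynD m.+4) b)%N.
have e2 : (m.+4 - 2 = m.+2)%N by rewrite !subSS subn0.
have e3 : (m.+4 - 3 = m.+1)%N by rewrite !subSS subn0.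
have E0 b : dynkin_entry (DynD m.+4) a b = (0 < dynkin_edges (DynD m.+4) a b)%N.
  by [].
have [am|am] := ltnP a m.+1.
  apply: (leq_ltn_trans (@sum_le_support m.+4 f [:: a.-1; a.+1] _)).
    move=> b bn; rewrite !inE negb_or => /andP[/eqP b1 /eqP b2].
    rewrite /f E0 /dynkin_edges /= ?e2 ?e3.
    by case: (ltngtP a b) => ab //; rewrite (_ : _ || _ = false) //; lia.
  rewrite !big_cons big_nil /f !E0.
  clear f E0; case: a am an => [|a] am an;
    rewrite ?dynkin_edgesxx ?dynkin_edgesSr ?dynkin_edgesSl /= ?eqxx /= ?e2 ?e3;
    do ? case: ifP => ?; nia.
have : [|| a == m.+1, a == m.+2 | a == m.+3] by lia.
case/or3P=> /eqP aE.
- apply: (leq_ltn_trans (@sum_le_support m.+4 f [:: m; m.+2; m.+3] _)).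
    move=> b bn; rewrite !inE !negb_or => /and3P[/eqP b1 /eqP b2 /eqP b3].
    rewrite /f E0 /dynkin_edges /= ?e2 ?e3.
    by case: (ltngtP a b) => ab //; rewrite (_ : _ || _ = false) //; lia.
  rewrite !big_cons big_nil /f !E0 aE /= ?e2 ?e3.
  by do ? case: ifP => ?; nia.
- apply: (leq_ltn_trans (@sum_le_support m.+4 f [:: m.+1] _)).
    move=> b bn; rewrite !inE => /eqP b1.
    rewrite /f E0 /dynkin_edges /= ?e2 ?e3.
    by case: (ltngtP a b) => ab //; rewrite (_ : _ || _ = false) //; lia.
  rewrite !big_cons big_nil /f !E0 aE /= ?e2 ?e3.
  by do ? case: ifP => ?; nia.
- apply: (leq_ltn_trans (@sum_le_support m.+4 f [:: m.+1] _)).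
    move=> b bn; rewrite !inE => /eqP b1.
    rewrite /f E0 /dynkin_edges /= ?e2 ?e3.
    by case: (ltngtP a b) => ab //; rewrite (_ : _ || _ = false) //; lia.
  rewrite !big_cons big_nil /f !E0 aE /= ?e2 ?e3.
  by do ? case: ifP => ?; nia.
Qed.

Lemma dynkin_dominated T a : dynkin_valid T -> (a < dynkin_rank T)%N ->
  (\sum_(b < dynkin_rank T) dynkin_entry T a b * dynkin_label T b
     < 2 * dynkin_label T a)%N.
Proof.
case: T => [n|n|n|n|n||] /=.
- by move=> _; exact: dynkin_dominated_A.
- exact: dynkin_dominated_B.
- exact: dynkin_dominated_C.
- exact: dynkin_dominated_D.
- move=> hn; have : [|| n == 6, n == 7 | n == 8] by lia.
  by case/or3P=> /eqP ->; rewrite !big_ord_recl big_ord0; move: a; do 8 case=> //.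
- by rewrite !big_ord_recl big_ord0; move: a; do 4 case=> //.
- by rewrite !big_ord_recl big_ord0; move: a; do 2 case=> //.
Qed.

(** * Matrices over Z[t]/(t^2 - 1) *)

Section Evaluation.

(** Evaluation of the remainder. It is multiplicative for a = 1 and a = -1, where t^2 - 1 vanishes:
    the value at 1 carries the arrows, and the value at -1 brings in the signs of the Cartan
    counterpart. *)
Definition zt_eval (a : int) (x : zt) : int := (x : {poly int}).[a].

Lemma zt_evalD a x y : zt_eval a (x + y) = zt_eval a x + zt_eval a y.
Proof. exact: hornerD. Qed.

Lemma zt_evalN a x : zt_eval a (- x) = - zt_eval a x.
Proof. exact: hornerN. Qed.

Lemma zt_eval0 a : zt_eval a 0 = 0.
Proof. exact: horner0. Qed.

Lemma zt_eval_mod a (p : {poly int}) : a * a = 1 ->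
  zt_eval a (in_qpoly ('X^2 - 1) p) = p.[a].
Proof.
move=> aa; rewrite /zt_eval /=.
have q0 : (mk_monic ('X^2 - 1 : {poly int})).[a] = 0.
  by rewrite zt_modulus hornerD hornerN hornerXn hornerC expr2 aa subrr.
rewrite [in RHS](Pdiv.RingMonic.rdivp_eq (monic_mk_monic ('X^2 - 1 : {poly int})) p).
by rewrite hornerD hornerM q0 mulr0 add0r.
Qed.

Lemma zt_evalM a x y : a * a = 1 -> zt_eval a (x * y) = zt_eval a x * zt_eval a y.
Proof. by move=> aa; rewrite -hornerM -(zt_eval_mod _ aa). Qed.

Lemma zt_eval1 a : a * a = 1 -> zt_eval a 1 = 1.
Proof. by move=> aa; rewrite -[1 in LHS]in_qpoly1 zt_eval_mod // hornerC. Qed.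

Lemma zt_evalt a : a * a = 1 -> zt_eval a zt_t = a.
Proof. by move=> aa; rewrite zt_eval_mod // hornerX. Qed.

Lemma zt_evalMz a x (m : int) : zt_eval a (x *~ m) = zt_eval a x * m.
Proof.
have nat_case (y : zt) (l : nat) : zt_eval a (y *+ l) = zt_eval a y *+ l.
  by elim: l => [|l IH]; rewrite ?mulr0n ?zt_eval0 // !mulrS zt_evalD IH.
case: m => l; first by rewrite -pmulrn nat_case -mulr_natr natz.
by rewrite NegzE mulrNz -pmulrn zt_evalN nat_case mulrN -mulr_natr natz.
Qed.

Lemma zt_eval_int a (m : int) : a * a = 1 -> zt_eval a m%:~R = m.
Proof. by move=> aa; rewrite zt_evalMz zt_eval1 // mul1r. Qed.

Lemma sgzt_eval x : sgzt x = sgz (zt_eval 1 x).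
Proof.
rewrite /sgzt /zt_eval; have sx : (size (x : {poly int}) <= 2)%N.
  rewrite -ltnS (leq_trans (size_mk_monic x)) // zt_modulus.
  by rewrite size_polyDl ?size_polyXn // size_polyN size_poly1.
by rewrite (horner_coef_wide _ sx) !big_ord_recl big_ord0 /= !expr1n !mulr1 addr0.
Qed.

End Evaluation.

(** * Signed mutation at t = 1 and at t = -1 *)

Definition ev n (a : int) (B : 'M[zt]_n) : 'I_n -> 'I_n -> int :=
  fun i j => zt_eval a (B i j).

(** Signed mutation at t = -1. Its case distinctions are made on signs at t = 1, hence on [U]. *)
Definition mutV n (k : 'I_n) (U V : 'I_n -> 'I_n -> int) i j : int :=
  if (i == k) || (j == k) then
    if ((i == k) && (0 < U i j)) || ((j == k) && (U i j < 0)) then - V i j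
    else V i j
  else if 0 < U i k * U k j then - (V i j + sgz (U i k) * (V i k * V k j))
  else V i j.

Lemma sgz_eq1 (x : int) : (sgz x == 1) = (0 < x).
Proof. by case: sgzP. Qed.

Lemma sgz_eqN1 (x : int) : (sgz x == -1) = (x < 0).
Proof. by case: sgzP. Qed.

Section EvalMutation.
Variables (n : nat) (k : 'I_n) (B : 'M[zt]_n) (d : 'I_n -> nat).
Hypothesis Bskew : skew_by d (ev 1 B).

Let Ukk : zt_eval 1 (B k k) = 0 := skew_diag k Bskew.

Lemma ev1_mutation : ev 1 (mutation k B) = mutU k (ev 1 B).
Proof.
apply/funext => i; apply/funext => j; rewrite /ev mxE /mutU !sgzt_eval.
rewrite !sgz_eq1 !sgz_eqN1 zt_evalM // -/(ev 1 B i k).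
have [->|ik] := eqVneq i k; have [->|jk] := eqVneq j k => /=.
- by rewrite !Ukk !ltxx /= mulr0 ltxx oppr0 Ukk.
- rewrite !orbF /ev Ukk mul0r ltxx; case: ltrgtP => U0;
    rewrite ?zt_evalN ?zt_evalM ?zt_evalt ?mul1r //.
  by rewrite /ev -U0 oppr0.
- rewrite /ev Ukk mulr0 ltxx; case: ltrgtP => U0;
    rewrite ?zt_evalN ?zt_evalM ?zt_evalt ?mul1r //.
  by rewrite U0 oppr0.
case: ifP => // _; rewrite zt_evalM // zt_evalt // mul1r zt_evalD zt_evalMz zt_evalM //.
by rewrite [_ * sgz _]mulrC.
Qed.

Lemma evN1_mutation : ev (-1) (mutation k B) = mutV k (ev 1 B) (ev (-1) B).
Proof.
apply/funext => i; apply/funext => j; rewrite /ev mxE /mutV !sgzt_eval.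
rewrite !sgz_eq1 !sgz_eqN1 zt_evalM // -/(ev 1 B i k).
have [->|ik] := eqVneq i k; have [->|jk] := eqVneq j k => /=.
- by rewrite !Ukk !ltxx /= mulr0 ltxx.
- rewrite !orbF /ev Ukk mul0r ltxx; case: ltrgtP => U0;
    rewrite ?zt_evalN ?zt_evalM ?zt_evalt ?mulN1r ?opprK //.
- rewrite /ev Ukk mulr0 ltxx; case: ltrgtP => U0;
    rewrite ?zt_evalN ?zt_evalM ?zt_evalt ?mulN1r ?opprK //.
case: ifP => // _; rewrite zt_evalM // zt_evalt // mulN1r zt_evalD zt_evalMz zt_evalM //.
by rewrite [_ * sgz _]mulrC.
Qed.

End EvalMutation.

(** On an affected pair, with s the sign of U_ik, an old arrow opposes the path through k. So V_ij =
    - s C_ij and V_ik V_kj = C_ik C_kj; the new value is s (C_ij - C_ik C_kj), and a surviving entry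
    of the mutated [U] has sign s. *)
Lemma mutV_companion (R : rcfType) n d (U V C : 'I_n -> 'I_n -> int) k :
  finite_type R d U C -> (forall i j, V i j = sgz (U i j) * C i j) ->
  forall i j, mutV k U V i j = sgz (mutU k U i j) * mutC k U C i j.
Proof.
move=> ft VE i j; have Us := ft_skew ft; have Ukk := skew_diag k Us.
have Ckk := sym_diag (ft_pos ft).1 k.
have [ik|ik] := eqVneq i k.
  rewrite /mutV /mutU /mutC ik eqxx /= Ukk ltxx /= Ckk -(skew_lt0 k j Us) VE sgzN.
  have -> : (j == k) && (U k j < 0) = false.
    by case: eqP => // ->; rewrite Ukk.
  by rewrite orbF; case: sgzP => _; ring.
have [jk|jk] := eqVneq j k.
  rewrite /mutV /mutU /mutC jk eqxx /= orbT Ukk ltxx addbF Ckk VE sgzN (negPf ik) /=.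
  by case: sgzP => _; ring.
have [/and3P[ki kj H]|H] :=
  boolP [&& adjacent C k i, adjacent C k j & (0 < U i k) (+) (0 < U j k)]; last first.
  have [-> UE] := mut_unaffected ft ik jk H; rewrite UE.
  move: UE; rewrite /mutV /mutU (negPf ik) (negPf jk) /=; case: ifP => // pos.
  have U0 : U i k != 0 by apply: contraTneq pos => ->; rewrite mul0r.
  move=> /eqP; rewrite -subr_eq0 addrAC subrr add0r mulf_eq0 sgz_eq0 (negPf U0) /=.
  by rewrite (gt_eqF pos).
have ij : i != j by apply: contraTneq H => ->; rewrite addbb.
have fik : flow (0 < U i k) U i k.
  by apply: (flow_into ft); rewrite (adjacent_sym (ft_pos ft).1).
have fkj : flow (0 < U i k) U k j.
  by have := flow_outof ft kj; move: H; case: (0 < U i k); case: (0 < U j k).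
have [_ f1 f2 _ _] := mut_affected ft ij fik fkj.
have pos : 0 < U i k * U k j.
  move: fik fkj; move: (0 < U i k) => []; rewrite /flow => u1 u2; first exact: mulr_gt0.
  by rewrite nmulr_rgt0.
pose s := sgz (U i k).
have sE b x y : flow b U x y -> sgz (U x y) = if b then 1 else -1.
  by rewrite /flow; case: b; case: sgzP.
have sE' b x y : flow b (mutU k U) x y -> sgz (mutU k U x y) = if b then 1 else -1.
  by rewrite /flow; case: b; case: sgzP.
have C'E : mutC k U C i j = C i j - C i k * C k j by rewrite /mutC H.
have -> : mutV k U V i j = s * mutC k U C i j.
  rewrite /mutV (negPf ik) (negPf jk) /= pos !VE C'E /s (sE _ _ _ fik) (sE _ _ _ fkj).
  have -> : sgz (U i j) * C i j = - (if 0 < U i k then 1 else -1) * C i j.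
    have [/f2|] := boolP (adjacent C i j).
      by rewrite (flow_sym _ _ _ Us) => /sE ->; case: (0 < U i k).
    by rewrite /adjacent ij negbK => /eqP ->; rewrite !mulr0.
  by case: (0 < U i k); ring.
have [C0|C0] := eqVneq (mutC k U C i j) 0; first by rewrite C0 !mulr0.
by rewrite (sE' (0 < U i k)) ?f1 /adjacent ?ij // /s (sE _ _ _ fik).
Qed.

Lemma mutUK n (d : 'I_n -> nat) (U : 'I_n -> 'I_n -> int) k :
  skew_by d U -> mutU k (mutU k U) = U.
Proof.
move=> Us; apply/funext => i; apply/funext => j.
have Ukk := skew_diag k Us.
rewrite {1}/mutU; case: ifP => [ijk|/norP[ik jk]].
  by rewrite /mutU ijk opprK.
rewrite /mutU eqxx (negPf ik) (negPf jk) /= ?orbT mulrNN.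
by case: ifP => pos; rewrite pos // sgzN mulNr addrK.
Qed.

(** Changing signs of basis vectors is a substitution in the quadratic form and leaves absolute
    values and adjacency alone. *)
Lemma switch_finite_type (R : rcfType) n d (U C : 'I_n -> 'I_n -> int)
    (s : 'I_n -> int) :
  (forall i, s i * s i = 1) -> finite_type R d U C ->
  finite_type R d U (fun i j => s i * s j * C i j).
Proof.
move=> ss [[Csym Cpos] Us CU Ccyc].
have sN0 i : s i != 0 by apply: contra_eq_neq (ss i) => ->; rewrite mul0r.
have s1 i : `|s i| = 1.
  have := ss i; case: (ger0P (s i)) => ?; nia.
split=> //.
- split; first split=> [i|i j|i]; rewrite ?(sym_gt0 Csym) ?ss ?(sym_diag Csym) //.
    by rewrite mulrCA (symE Csym) mulrCA [s i * _]mulrC.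
  move=> x [i xi]; have := Cpos (fun i => (s i)%:~R * x i).
  have -> : quad_form d C (fun i => (s i)%:~R * x i) =
      quad_form d (fun i j => s i * s j * C i j) x.
    apply: eq_bigr => a _; apply: eq_bigr => b _; rewrite !rmorphM /=; ring.
  by apply; exists i; rewrite mulf_neq0 // intr_eq0.
- by move=> i j ij; rewrite !normrM !s1 !mul1r CU.
move=> p ics; apply: Ccyc; apply: eq_in_induced_cycle ics => x y _ _.
by rewrite /adjacent !mulf_eq0 !(negPf (sN0 _)).
Qed.

(* The entries of a pure B(Q, v) satisfy b(-1) = sgn(b(1)) c, whatever the sign of
   the arrow. *)
Definition tame (R : rcfType) n (B : 'M[zt]_n) : Prop :=
  exists d C, finite_type R d (ev 1 B) C /\
    forall i j, ev (-1) B i j = sgz (ev 1 B i j) * C i j.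

Lemma tame_mutation (R : rcfType) n k (B : 'M[zt]_n) :
  tame R B -> tame R (mutation k B).
Proof.
move=> [d [C [ft VE]]]; exists d, (mutC k (ev 1 B) C).
rewrite (ev1_mutation k (ft_skew ft)); split; first exact: finite_type_mut.
by move=> i j; rewrite (evN1_mutation k (ft_skew ft)); exact: mutV_companion ft VE i j.
Qed.

(** Mutation equivalence may run in either direction, and signed mutation is not an involution:
    applied twice at k it multiplies row and column k by t. At t = -1 this is undone by switching
    the sign of the k-th basis vector. *)
Lemma tame_unmutation (R : rcfType) n k (B : 'M[zt]_n) d0 :
  skew_by d0 (ev 1 B) -> tame R (mutation k B) -> tame R B.
Proof.
move=> Bskew [d [C [ft VE]]].
rewrite (ev1_mutation k Bskew) (evN1_mutation k Bskew) in ft VE.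
have ft2 := finite_type_mut k ft; have VE2 := mutV_companion k ft VE.
rewrite (mutUK k Bskew) in ft2 VE2.
move: ft VE VE2; set U := ev 1 B; set V := ev (-1) B => ft VE VE2.
have Ukk : U k k = 0 := skew_diag k Bskew.
pose s i : int := if i == k then -1 else 1.
have ss i : s i * s i = 1 by rewrite /s; case: ifP.
exists d, (fun i j => s i * s j * mutC k (mutU k U) C i j).
split; first exact: switch_finite_type.
move=> i j; rewrite mulrCA -VE2 -/V {VE2}.
have := VE i j; rewrite /s /mutV /mutU.
have [->|ik] := eqVneq i k; have [->|jk] := eqVneq j k;
  rewrite ?eqxx ?(negPf ik) ?(negPf jk) /= ?orbT ?orbF /=.
- by rewrite Ukk oppr0 ltxx /= sgz0 mul0r => ->; rewrite mulr0.
- rewrite oppr_gt0; case: (ltrgtP (U k j) 0) => U0 /= VE0; [by ring|by ring|].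
  have V0 : V k j = 0 by rewrite VE0 ?U0 ?oppr0 sgz0 mul0r.
  by rewrite V0 mulr0.
- rewrite oppr_lt0; case: (ltrgtP (U i k) 0) => U0 /= VE0; [by ring|by ring|].
  have V0 : V i k = 0 by rewrite VE0 ?U0 ?oppr0 sgz0 mul0r.
  by rewrite V0 mulr0.
rewrite mulrNN sgzN => _; case: ifP => pos; rewrite ?pos; last by ring.
have -> : (U i k < 0) = ~~ (0 < U k j).
  case: (ltrgtP (U i k) 0) => u.
  - by move: pos; rewrite nmulr_rgt0 // => /lt_gtF ->.
  - by move: pos; rewrite pmulr_rgt0 // => ->.
  - by move: pos; rewrite u mul0r ltxx.
by case: (0 < U k j) => /=; ring.
Qed.

Lemma tame_mutations (R : rcfType) n (s : seq 'I_n) (B : 'M[zt]_n) :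
  tame R B -> tame R (mutations s B).
Proof.
by elim: s B => //= k s IH B tB; apply: IH; apply: tame_mutation.
Qed.

Lemma tame_unmutations (R : rcfType) n (s : seq 'I_n) (B : 'M[zt]_n) d :
  skew_by d (ev 1 B) -> tame R (mutations s B) -> tame R B.
Proof.
elim: s B => //= k s IH B Bskew tB; apply: (tame_unmutation Bskew).
by apply: IH tB; rewrite (ev1_mutation k Bskew); exact: mutU_skew.
Qed.

Lemma gss_skew n (B : 'M[zt]_n) : is_gss B -> exists d, skew_by d (ev 1 B).
Proof.
case=> d d_gt0 dB; exists d; split=> // i j.
have := congr1 (zt_eval 1) (dB i j); rewrite zt_evalN !pmulrn !zt_evalMz /ev.
by rewrite [_ * (d i)%:Z]mulrC [_ * (d j)%:Z]mulrC.
Qed.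

(** * The Cartan counterpart of a quiver as a companion of its matrix *)

Section Quiver.
Variables (n : nat) (Q : svquiver n).

Lemma arrow_irr i : arrow Q i i = false.
Proof. by case: Q => a v1 v2 irr _ _ _ /=; apply/negbTE. Qed.

Lemma arrow_asym i j : arrow Q i j -> arrow Q j i = false.
Proof. by case: Q => a v1 v2 _ asym _ _ /= /asym/negbTE. Qed.

Lemma arrow_sgz i j : arrow Q i j ->
  sgz (arrow_v1 Q i j) = sgz (arrow_v2 Q i j) /\ arrow_v1 Q i j != 0.
Proof.
by case: Q => a v1 v2 _ _ sg _ /= /sg[e]; rewrite sgz_eq0.
Qed.

Lemma ev1_quiver i j : ev 1 (quiver_matrix Q) i j =
  if arrow Q i j then `|arrow_v1 Q i j|
  else if arrow Q j i then - `|arrow_v2 Q j i| else 0.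
Proof.
rewrite /ev mxE; case: ifP => [/arrow_sgz[e nz]|_].
  case: ifP => v0; rewrite ?zt_evalN ?zt_evalM ?zt_evalt ?zt_eval_int //.
    by rewrite gtr0_norm.
  by rewrite mul1r ler0_norm // leNgt v0.
case: ifP => [/arrow_sgz[e nz]|_]; last by rewrite zt_eval0.
case: ifP => v0; rewrite ?zt_evalN ?zt_evalM ?zt_evalt ?zt_eval_int //.
  by rewrite gtr0_norm // -sgz_gt0 -e sgz_gt0.
by rewrite mul1r ler0_norm ?opprK // -sgz_le0 -e sgz_le0 leNgt v0.
Qed.

Lemma evN1_quiver i j : ev (-1) (quiver_matrix Q) i j =
  if arrow Q i j then arrow_v1 Q i j
  else if arrow Q j i then - arrow_v2 Q j i else 0.
Proof.
rewrite /ev mxE; case: ifP => [/arrow_sgz[e nz]|_].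
  case: ifP => v0; rewrite ?zt_evalN ?zt_evalM ?zt_evalt ?zt_eval_int //.
  by rewrite mulN1r opprK.
case: ifP => [/arrow_sgz[e nz]|_]; last by rewrite zt_eval0.
case: ifP => v0; rewrite ?zt_evalN ?zt_evalM ?zt_evalt ?zt_eval_int //.
by rewrite mulN1r.
Qed.

Lemma arrow_v2_neq0 i j : arrow Q i j -> arrow_v2 Q i j != 0.
Proof. by move=> /arrow_sgz[e]; rewrite -sgz_eq0 e sgz_eq0. Qed.

Lemma arrow_ev1 i j : arrow Q i j = (0 < ev 1 (quiver_matrix Q) i j).
Proof.
rewrite ev1_quiver; case: ifP => [/arrow_sgz[_ nz]|_]; first by rewrite normr_gt0.
by case: ifP; rewrite ?ltxx // oppr_gt0 ltNge normr_ge0.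
Qed.

Lemma cartan_diag i : cartan Q i i = 2.
Proof. by rewrite mxE eqxx. Qed.

Lemma evN1_cartan i j : ev (-1) (quiver_matrix Q) i j =
  sgz (ev 1 (quiver_matrix Q) i j) * cartan Q i j.
Proof.
rewrite ev1_quiver evN1_quiver mxE; have [->|ij] := eqVneq i j.
  by rewrite arrow_irr sgz0 mul0r.
case: ifP => [/arrow_sgz[_ nz]|_]; first by rewrite gtr0_sgz ?normr_gt0 ?mul1r.
case: ifP => [ji|_]; last by rewrite sgz0 mul0r.
by rewrite sgzN gtr0_sgz ?normr_gt0 ?arrow_v2_neq0 ?mulN1r.
Qed.

Lemma cartan_abs i j : i != j -> `|cartan Q i j| = `|ev 1 (quiver_matrix Q) i j|.
Proof.
move=> ij; rewrite ev1_quiver mxE (negPf ij); case: ifP; rewrite ?normr_id //.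
by case: ifP; rewrite ?normrN ?normr_id.
Qed.

(** Off the diagonal, a nonzero value at 1 has a sign that can be cancelled; where this value is 0,
    the absolute values force both entries to be 0. *)
Lemma cartan_unique (R : rcfType) d C :
  finite_type R d (ev 1 (quiver_matrix Q)) C ->
  (forall i j, ev (-1) (quiver_matrix Q) i j =
     sgz (ev 1 (quiver_matrix Q) i j) * C i j) ->
  C = cartan Q.
Proof.
move=> ft VE; apply/funext => i; apply/funext => j.
have [->|ij] := eqVneq i j; first by rewrite cartan_diag (sym_diag (ft_pos ft).1).
have [U0|U0] := eqVneq (ev 1 (quiver_matrix Q) i j) 0.
  have := ft_abs ft ij; have := cartan_abs ij; rewrite U0 normr0.
  by move=> /eqP + /eqP; rewrite !normr_eq0 => /eqP -> /eqP ->.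
have := VE i j; rewrite evN1_cartan => /mulfI -> //; by rewrite sgz_eq0.
Qed.

End Quiver.

(** * Tameness of mutation Dynkin matrices *)

Lemma dynkin_edges_le3 T a b : (dynkin_edges T a b <= 3)%N.
Proof.
rewrite /dynkin_edges; case: ifP => _; last case: ifP => _ //.
  by case: T => [n|n|n|n|n||] /=; lia.
by case: T => [n|n|n|n|n||] /=; lia.
Qed.

(** Of two positive factors with product at most 3, one is 1. *)
Lemma bond_entry (a b : nat) : (a * b <= 3)%N -> (a == 0%N) = (b == 0%N) ->
  a = (if b < a then a * b else (0 < a * b) : nat)%N.
Proof. by move=> ab3 ab0; case: ifP => ?; nia. Qed.

Lemma dynkin_tame (R : rcfType) n (D : 'M[zt]_n) : is_dynkin D -> tame R D.
Proof.
case=> _ _ [Q -> [T [Tval Tn [s sE]]]].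
have [d d_gt0 dQ] : exists2 d : 'I_n -> nat, forall i, (0 < d i)%N &
    forall i j, arrow Q i j -> (d i)%:Z * arrow_v1 Q i j = (d j)%:Z * arrow_v2 Q i j.
  by case: (Q).
exists d, (cartan Q); split; last exact: evN1_cartan.
have Csym : symmetrizable_by d (cartan Q).
  split=> // [i j|i]; last exact: cartan_diag.
  rewrite !mxE eq_sym; case: eqP => [->//|_].
  case: ifP => ij; first by rewrite (arrow_asym ij) dQ.
  by case: ifP => ji; rewrite ?mulr0 ?dQ.
apply: (@dominated_finite_type R n d _ _ (fun i => dynkin_label T (s i))) => //.
- split=> // i j; rewrite !ev1_quiver.
  case: ifP => ij; last first.
    case: ifP => ji; last by rewrite !mulr0 oppr0.
    have := congr1 (@Num.norm _ _) (dQ _ _ ji); rewrite !normrM.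
    by rewrite [`|(d i)%:Z|]ger0_norm // [`|(d j)%:Z|]ger0_norm // mulrN => ->.
  rewrite (arrow_asym ij).
  have := congr1 (@Num.norm _ _) (dQ _ _ ij); rewrite !normrM mulrN opprK.
  by rewrite [`|(d i)%:Z|]ger0_norm // [`|(d j)%:Z|]ger0_norm.
- exact: cartan_abs.
- by move=> i; apply: dynkin_label_gt0 => //; rewrite Tn.
move=> i; apply: leq_ltn_trans (_ : _ <= \sum_(b < dynkin_rank T)
    dynkin_entry T (s i) b * dynkin_label T b)%N _; last first.
  by apply: dynkin_dominated => //; rewrite Tn.
rewrite Tn [leqRHS](reindex_inj (@perm_inj _ s)) /= [leqLHS]big_mkcond; apply: leq_sum => j _.
have [->//|ji /=] := eqVneq j i; rewrite leq_mul2r; apply/orP; right.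
have [edgeE largeE] := sE i j.
have eE : edges (unsigned_diagram Q) i j = (`|cartan Q i j| * `|cartan Q j i|)%N.
  rewrite /= !mxE eq_sym (negPf ji) -abszM.
  case: ifP => ij; first by rewrite (arrow_asym ij).
  by case: ifP => // ji'; rewrite mulrC.
have lE : larger (unsigned_diagram Q) i j = (`|cartan Q j i| < `|cartan Q i j|)%N.
  rewrite /= !mxE (negPf ji) eq_sym (negPf ji).
  have [ij|_] := boolP (arrow Q i j); first by rewrite (arrow_asym ij) orbF.
  by case: (arrow Q j i).
rewrite /dynkin_entry -edgeE -largeE eE lE -bond_entry //.
  by rewrite -eE edgeE dynkin_edges_le3.
by rewrite !absz_eq0 -!(sgz_eq0 (cartan Q _ _)) (companion_sgz Csym).
Qed.

Lemma mutation_dynkin_tame (R : rcfType) n (B : 'M[zt]_n) :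
  is_mutation_dynkin B -> tame R B.
Proof.
case=> /gss_skew[d Bskew] [D /(dynkin_tame R) tD [[s ->]|[s DE]]].
  exact: tame_mutations.
by apply: (tame_unmutations (s := s) Bskew); rewrite -DE.
Qed.

(** The mutated companion of [Q] satisfies the conditions of [cartan_unique] for the mutated matrix,
    hence equals [cartan Q']. *)
Lemma cartan_mutation (R : rcfType) n (k : 'I_n) (Q Q' : svquiver n) :
  is_mutation_dynkin (quiver_matrix Q) -> quiver_mutation k Q Q' ->
  forall i j, cartan Q' i j = cartan Q i j -
    (if arrow Q i k (+) arrow Q j k then cartan Q i k * cartan Q k j else 0).
Proof.
move=> /(mutation_dynkin_tame R)[d [C [ft VE]]] mutQ i j.
have CE := cartan_unique ft VE; rewrite CE in ft VE.
have Uskew := ft_skew ft.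
have ft' := finite_type_mut k ft; have VE' := mutV_companion k ft VE.
rewrite -(ev1_mutation k Uskew) -(evN1_mutation k Uskew) -mutQ in ft' VE'.
by rewrite -(cartan_unique ft' VE') /mutC !arrow_ev1.
Qed.

(** * Root spaces *)

Section LieBracket.
Variables (F : fieldType) (L : lieAlgType F).
Implicit Types (x y z : L).

Lemma lie_bracketDl x y z : [lie x + y, z] = [lie x, z] + [lie y, z].
Proof. by have := lie_bracketPl 1 x y z; rewrite !scale1r. Qed.

Lemma lie_bracket0l z : [lie (0 : L), z] = 0.
Proof. by apply: (addrI [lie (0 : L), z]); rewrite -lie_bracketDl !addr0. Qed.

Lemma lie_bracketZl a x z : [lie a *: x, z] = a *: [lie x, z].
Proof. by have := lie_bracketPl a x 0 z; rewrite !addr0 lie_bracket0l addr0. Qed.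

Lemma lie_bracketBl x y z : [lie x - y, z] = [lie x, z] - [lie y, z].
Proof. by rewrite -scaleN1r lie_bracketDl lie_bracketZl scaleN1r. Qed.

Lemma lie_bracket_suml (I : finType) (f : I -> L) z :
  [lie \sum_i f i, z] = \sum_i [lie f i, z].
Proof.
by apply: (big_morph (fun x => [lie x, z])) => [x y|]; rewrite ?lie_bracketDl ?lie_bracket0l.
Qed.

End LieBracket.

Section RootSpaces.
Variables (R : realType) (n : nat).
Implicit Types (Q : svquiver n) (beta : 'rV[R]_n) (i j k : 'I_n).

Definition root_at Q beta j : R[i] := \sum_i (beta 0 i)%:C%C * (cartan Q j i)%:~R.

(** A value of the root at [h] always comes with an expression of [h] as a combination of the h_j,
    so by linearity it is enough to test the h_j. *)
Lemma root_spaceP Q beta (x : lieQ R Q) :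
  root_space Q beta x <-> forall j, [lie hgen R Q j, x] = root_at Q beta j *: x.
Proof.
split=> [Hx j|Hx h c _ [a -> ->]].
  apply: Hx; first by apply: lie_generated_gen; exists j.
  exists (fun l => (l == j)%:R).
    rewrite (bigD1 j) //= eqxx scale1r big1 ?addr0 // => l /negPf ->.
    by rewrite scale0r.
  rewrite [RHS](bigD1 j) //= eqxx mul1r [X in _ = _ + X]big1 ?addr0 // => l /negPf ->.
  by rewrite mul0r.
rewrite (lie_bracket_suml (L := lieQ R Q)) scaler_suml; apply: eq_bigr => j _.
by rewrite (lie_bracketZl (L := lieQ R Q)) Hx scalerA.
Qed.

Lemma root_at_root_mutation Q k beta j :
  root_at Q (root_mutation Q k beta) j = \sum_l (beta 0 l)%:C%C *
    ((cartan Q j l)%:~R -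
       (if arrow Q l k then (cartan Q k l)%:~R * (cartan Q j k)%:~R else 0)).
Proof.
rewrite /root_at /root_mutation.
(* Reflection at k moves only the coordinate at k. *)
have rE (i : 'I_n) : (\sum_l beta 0 l *: (if arrow Q l k then reflection Q k (simple_root R l)
     else simple_root R l)) 0 i = beta 0 i -
     (i == k)%:R * \sum_l beta 0 l * (if arrow Q l k then (cartan Q k l)%:~R else 0).
  rewrite summxE mulr_sumr.
  transitivity (\sum_l (beta 0 l * (i == l)%:R - (i == k)%:R * (beta 0 l *
      (if arrow Q l k then (cartan Q k l)%:~R else 0)))).
    apply: eq_bigr => l _; rewrite /reflection; move: (cartan Q) => C.
    rewrite !mxE; case: ifP => _; last first.
      by rewrite !mxE eqxx /= mulr0 mulr0 subr0.
    rewrite !mxE !eqxx /= (bigD1 l) //= big1 ?addr0.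
      by rewrite mxE !eqxx mul1r; ring.
    by move=> p /negPf pl; rewrite mxE pl andbF mul0r.
  rewrite sumrB; congr (_ - _); rewrite (bigD1 i) //= eqxx mulr1 big1 ?addr0 //.
  by move=> l; rewrite eq_sym => /negPf ->; rewrite mulr0.
under eq_bigr do rewrite rE rmorphB rmorphM rmorph_nat mulrBl -mulrA.
rewrite sumrB; have sumk (z : R[i]) :
    \sum_i (i == k)%:R * (z * (cartan Q j i)%:~R) = z * (cartan Q j k)%:~R :> R[i].
  rewrite (bigD1 k) //= eqxx mul1r big1 ?addr0 // => i /negPf ->.
  by rewrite mul0r.
rewrite sumk rmorph_sum mulr_suml -sumrB; apply: eq_bigr => l _.
rewrite rmorphM mulrBr -mulrA; congr (_ - _ * _).
by case: ifP => _; rewrite ?rmorph_int ?rmorph0 ?mul0r.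
Qed.

(** The right-hand side is the value of the mutated root at h_j - [j -> k] c_jk h_k, the image of
    h'_j. By [cartan_mutation] the sides agree in each of the four cases for arrows from j and l
    into k; when both arrows occur, the corrections cancel because c_kk = 2. *)
Lemma root_at_mutation Q Q' k beta j :
  is_mutation_dynkin (quiver_matrix Q) -> quiver_mutation k Q Q' ->
  root_at Q' beta j = root_at Q (root_mutation Q k beta) j -
    (if arrow Q j k then (cartan Q j k)%:~R * root_at Q (root_mutation Q k beta) k
     else 0).
Proof.
move=> dynQ mutQ; rewrite !root_at_root_mutation /root_at.
have -> : (if arrow Q j k then (cartan Q j k)%:~R * \sum_l (beta 0 l)%:C%C *
    ((cartan Q k l)%:~R - (if arrow Q l k then (cartan Q k l)%:~R * (cartan Q k k)%:~R else 0))
    else 0) = \sum_l (beta 0 l)%:C%C * (if arrow Q j k then (cartan Q j k)%:~R *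
    ((cartan Q k l)%:~R - (if arrow Q l k then (cartan Q k l)%:~R * 2 else 0)) else 0) :> R[i].
  rewrite cartan_diag; case: ifP => _; last by rewrite big1 // => l _; rewrite mulr0.
  by rewrite mulr_sumr; apply: eq_bigr => l _; rewrite mulrCA.
rewrite -sumrB; apply: eq_bigr => l _; rewrite -mulrBr; congr (_ * _).
rewrite (cartan_mutation R dynQ mutQ) rmorphB /=.
case: (arrow Q j k); case: (arrow Q l k) => /=;
  rewrite ?rmorphM /= ?rmorph0; ring.
Qed.

End RootSpaces.

Theorem theoremB (R : realType) (n : nat) (Q Q' : svquiver n) (k : 'I_n)
    (phi : {linear lieQ R Q' -> lieQ R Q}) :
  is_mutation_dynkin (quiver_matrix Q) ->
  quiver_mutation k Q Q' ->
  lie_iso phi ->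
  is_phi k phi ->
  forall beta' : 'rV[R]_n, root_system Q' beta' ->
    phi @` root_space Q' beta' = root_space Q (root_mutation Q k beta').
Proof.
move=> dynQ mutQ [phiM [psi phiK psiK]] [_ phih] beta _.
pose rho := root_mutation Q k beta.
(* The eigenvalue equations for the h_j and for the images of the h'_j differ by an invertible
   change that only subtracts multiples of h_k. *)
have hE (y : lieQ R Q) :
    (forall j, [lie hgen R Q j, y] = root_at Q rho j *: y) <->
    (forall j, [lie phi (hgen R Q' j), y] = root_at Q' beta j *: y).
  split=> H j.
    rewrite phih (root_at_mutation _ _ dynQ mutQ); case: ifP => _; last by rewrite subr0 H.
    rewrite (lie_bracketBl (L := lieQ R Q)) (lie_bracketZl (L := lieQ R Q)) !H.
    by rewrite scalerA scalerBl.
  (* As [Q] has no loop, h'_k is sent to h_k itself, and the equation for h_k recovers the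
     others. *)
  have := H j; have := H k.
  rewrite !phih !(root_at_mutation _ _ dynQ mutQ) arrow_irr subr0 => Hk.
  case: ifP => _; last by rewrite subr0.
  rewrite (lie_bracketBl (L := lieQ R Q)) (lie_bracketZl (L := lieQ R Q)) Hk.
  by rewrite scalerA scalerBl => /addIr.
apply/seteqP; split=> [_ [x /root_spaceP xb <-]|y /root_spaceP /hE yb].
  apply/root_spaceP/hE => j; rewrite -phiM xb.
  exact: linearZ.
exists (psi y) => //; apply/root_spaceP => j; apply: (can_inj phiK).
by rewrite phiM psiK yb linearZ psiK.
Qed.
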